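(* Let $t_0=\frac12+\frac{1}{2\sqrt3}$, $\alpha\in(0,1)\cup(1,\infty)$, $t>0$, and $G_{\alpha,t}(\lambda)=\Gamma(t)^{1-\alpha}\,\alpha^{\alpha\lambda}\,\frac{\Gamma(\lambda+t)^\alpha}{\Gamma(\alpha\lambda+t)}$, $\lambda\ge0$. 1) $G_{\alpha,t}$ is the Laplace transform of a random variable $X_{\alpha,t}\sim\mathrm{SD}_0(\mathbb{R}_+)$ if and only if $\alpha\in(0,1)$ and $t\ge t_0$. 2) $1/G_{\alpha,t}$ is the Laplace transform of a random variable $Y_{\alpha,t}\sim\mathrm{SD}_0(\mathbb{R}_+)$ if and only if $\alpha\in(1,\infty)$ and $t\ge t_0$.
   Context: A nonnegative random variable $X$ is in $\mathrm{SD}_0(\mathbb{R}_+)$ (selfdecomposable) if for every $c\in(0,1)$ there is a random variable $V_c$ independent of $X$ with $X\overset{d}{=}cX+V_c$. Equivalently, $-\log\mathbb{E}[e^{-\lambda X}]=d\lambda+\int_0^\infty(1-e^{-\lambda x})\frac{k(x)}{x}dx$ with $d\ge0$ and $k\ge 0$ non-increasing. *)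

(* Defs.v *)
From HB Require Import structures.
From mathcomp Require Import all_boot all_order all_algebra.
From mathcomp Require Import all_classical all_reals all_analysis.
Set Implicit Arguments. Unset Strict Implicit. Unset Printing Implicit Defensive.
Import Order.TTheory GRing.Theory Num.Theory.
Local Open Scope classical_set_scope.
Local Open Scope ring_scope.

Section Defs.
Variable R : realType.

Definition Gamma (t : R) : R :=
  Rintegral lebesgue_measure `]0%R, +oo[%classic (fun x : R => x `^ (t - 1) * expR (- x)).

Definition G (alpha t lam : R) : R :=
  Gamma t `^ (1 - alpha) * alpha `^ (alpha * lam) * (Gamma (lam + t)) `^ alpha
  / Gamma (alpha * lam + t).

Definition laplace (mu : probability R R) (lam : R) : \bar R :=
  (\int[mu]_x (expR (- lam * x))%:E)%E.

Definition nonneg_law (mu : probability R R) : Prop := mu `]-oo, 0%R[%classic = 0%E.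

(* Selfdecomposability of the law mu of X: for every c in (0,1) there is V_c
   (with law nu) independent of X such that X =d cX + V_c; independence means
   that the joint law of (X, V_c) is the product measure mu x nu. *)
Definition selfdecomposable (mu : probability R R) : Prop :=
  forall c : R, 0 < c < 1 ->
    exists nu : probability R R,
      forall A : set R, measurable A ->
        mu A = (mu \x nu)%E ((fun p : R * R => c * p.1 + p.2) @^-1` A).

Definition is_SD0_laplace (L : R -> R) : Prop :=
  exists mu : probability R R,
    [/\ nonneg_law mu, selfdecomposable mu &
        forall lam : R, 0 <= lam -> laplace mu lam = (L lam)%:E].

Definition t0 : R := 2^-1 + (2 * Num.sqrt 3)^-1.

End Defs.

(* Main.v *)
(* Put p(x) = x e^{-tx} / (1 - e^{-x}). A Binet formula (both sides have the same
   differences under l -> l + 1, and the same asymptotics) writes ln Gamma(l + t) as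
   elementary terms plus \int_0^oo e^{-lx} (p(x) - 1 + (t - 1/2) x) / x^2 dx. Hence
   L = G (for alpha < 1, with a = 1, b = 1/alpha) and L = 1/G (for alpha > 1, with
   a = 1/alpha, b = 1) both satisfy, with w = alpha,
     ln L(l) = A - k0 ln l + \int_0^oo e^{-lx} (k(x) - k0) / x dx,
     k(x) = w (p(ax) - p(bx)) / x,   k0 = k(0+) = w (b - a) (t - 1/2).
   As ln L(l) = O(l) at l = 0, this is a Levy-Khintchine formula with Levy density
   k(x) / x. The function k is nonincreasing as soon as p is convex, which holds when
   t >= t0, the larger root of the Bernoulli polynomial B_2. Then L is the transform of
   the convolution of a gamma law and a compound Poisson law, and L(l) / L(cl) that of a
   compound Poisson law; uniqueness of Laplace transforms gives X = cX + V_c in law.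
   Conversely, L <= 1 at infinity forces k0 >= 0, i.e. t >= 1/2, and the monotonicity of
   L(l) / L(cl) at infinity forces B_2(t) >= 0, so t >= t0. On the wrong side of alpha = 1
   the mean of the law would be negative. *)

Require Import Defs.
From HB Require Import structures.
From mathcomp Require Import all_boot all_order all_algebra.
From mathcomp Require Import all_classical all_reals all_analysis.
From mathcomp Require Import measurable_realfun ring lra.
Import Order.TTheory GRing.Theory Num.Theory.
Import numFieldNormedType.Exports.
Set Implicit Arguments. Unset Strict Implicit. Unset Printing Implicit Defensive.
Local Open Scope classical_set_scope.
Local Open Scope ring_scope.

(** * Uniqueness of Laplace transforms *)

(** No derivative of ln Gamma is ever formed. Its functional equation and its convexity (Hoelder's
    inequality) bound the slopes of its chords, and these bounds stand in for the digamma function: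
    in Binet's formula, in the behaviour at l = 0 and in the argument by the mean. The integral
    formulas hold for l > 0, where e^{-lx} makes every piece integrable. At l = 0 the terms k0 ln l
    and the integral diverge separately when k0 is not 0, and it is the Gamma side that shows their
    sum with A to be O(l). So the total mass of a Levy density is found as a limit along l = 1/(n +
    1), by monotone convergence, instead of by direct integration. For t >= t0 one has k0 > 0, so
    k(x) / x has infinite mass near 0. The gamma law of shape k0 takes off k0 e^{-rx} / x, with a
    rate r for which the rest stays nonnegative; the rest has finite mass, hence is compound
    Poisson. In the ratio L(l) / L(cl) the singular parts cancel and leave the density (k(x) -
    k(x/c)) / x, of mass -k0 ln c. *)

Lemma measurable_expRM (R : realType) (D : set R) (c : R) :
  measurable_fun D (fun x => expR (c * x)).
Proof.
by apply: measurableT_comp => //; exact: measurable_funM.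
Qed.

Lemma cvg_invn (R : realType) : n%:R^-1 @[n --> \oo] --> (0 : R).
Proof.
by apply/gtr0_cvgV0; [near=> n; rewrite ltr0n; near: n; exists 1%N|exact: cvgr_idn].
Unshelve. all: by end_near. Qed.

Section laplace_uniqueness.
Variable R : realType.
Implicit Types (mu : probability R R) (s x : R).

Local Notation Rp := (`[0, +oo[%classic : set R).

Lemma nonneg_law_integral mu (f : R -> \bar R) : nonneg_law mu ->
  measurable_fun [set: R] f -> (forall x, (0 <= f x)%E) ->
  (\int[mu]_x f x = \int[mu]_(x in Rp) f x)%E.
Proof.
move=> mu0 mf f0; rewrite (@ge0_negligible_integral _ _ _ mu setT `]-oo, 0[)//.
by congr (integral _ _ _); rewrite setTD setCitvl.
Qed.

(* [threshold s n x] tends to the indicator of [s < x] for [0 <= x], and it is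
   a polynomial in [expR (- x)]. *)
Definition threshold s n x : R :=
  (1 - expR (- n%:R * x)) ^+ Num.truncn (n%:R * expR (n%:R * s)).

Lemma threshold_ge0 s n x : 0 <= x -> 0 <= threshold s n x.
Proof.
move=> x0; by rewrite exprn_ge0// subr_ge0 -expR0 ler_expR mulNr oppr_le0 mulr_ge0.
Qed.

Lemma threshold_le1 s n x : 0 <= x -> threshold s n x <= 1.
Proof.
move=> x0; rewrite exprn_ile1//.
  by rewrite subr_ge0 -expR0 ler_expR mulNr oppr_le0 mulr_ge0.
Qed.

Lemma bernoulli_ineq (u : R) n : 0 <= u <= 1 -> 1 - n%:R * u <= (1 - u) ^+ n.
Proof.
move=> /andP[u0 u1]; elim: n => [|n IH]; first by rewrite expr0 mul0r subr0.
rewrite exprSr -natr1.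
have : (1 - n%:R * u) * (1 - u) <= (1 - u) ^+ n * (1 - u).
  by rewrite ler_wpM2r// subr_ge0.
apply: le_trans; have : 0 <= n%:R * u * u by rewrite !mulr_ge0.
lra.
Qed.

(** Bernoulli's inequality reduces this to n e^{-nd} <= 4 / (n d^2) with d = x - s, which follows
    from e^{nd} >= (1 + nd/2)^2. *)
Lemma threshold_ge s n x : 0 <= x -> s < x -> (0 < n)%N ->
  1 - 4 / (n%:R * (x - s) ^+ 2) <= threshold s n x.
Proof.
move=> x0 sx n0; set d := x - s; have d0 : 0 < d by rewrite subr_gt0.
have nR : 0 < n%:R :> R by rewrite ltr0n.
apply: (@le_trans _ _ (1 - n%:R * expR (n%:R * s) * expR (- n%:R * x))).
  rewrite lerD2l lerN2 -mulrA -expRD (_ : _ + _ = - (n%:R * d)); last first.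
    by rewrite /d; ring.
  rewrite expRN ler_pdivrMr ?expR_gt0//.
  have nd0 : 0 < n%:R * d by exact: mulr_gt0.
  have : (1 + n%:R * d / 2) ^+ 2 <= expR (n%:R * d).
    rewrite [in leRHS](_ : n%:R * d = 2%:R * (n%:R * d / 2)); last by field.
    rewrite expRM_natl; apply: lerXn2r; rewrite ?nnegrE ?expR_ge0 ?expR_ge1Dx//.
    by rewrite addr_ge0// divr_ge0// ltW.
  have d2 : 0 < d ^+ 2 by exact: exprn_gt0.
  move=> H; rewrite mulrAC ler_pdivlMr ?mulr_gt0//.
  apply: le_trans (_ : 4 * (1 + n%:R * d / 2) ^+ 2 <= _); last by rewrite ler_pM2l.
  nra.
rewrite /threshold; set u := expR _; set N := Num.truncn _.
apply: le_trans (bernoulli_ineq N _); last first.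
  by rewrite expR_ge0 -expR0 ler_expR mulNr oppr_le0 mulr_ge0.
rewrite lerD2l lerN2 ler_wpM2r ?expR_ge0//.
by rewrite truncn_le mulr_ge0// expR_ge0.
Qed.

(** With u = e^{-nx} and N the exponent, (1 - u)^N <= e^{-Nu} <= 1 / (1 + Nu). Here N u >= n - 1,
    because u e^{ns} >= 1 and truncating the exponent costs at most u <= 1. *)
Lemma threshold_le s n x : 0 <= x -> x <= s -> (0 < n)%N -> threshold s n x <= n%:R^-1.
Proof.
move=> x0 xs n0; have nR : 0 < n%:R :> R by rewrite ltr0n.
rewrite /threshold; set u := expR _; set N := Num.truncn _.
have u1 : u <= 1 by rewrite -expR0 ler_expR mulNr oppr_le0 mulr_ge0.
have u0 : 0 < u by exact: expR_gt0.
have nu : n%:R - 1 <= N%:R * u.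
  have : n%:R * expR (n%:R * s) < N%:R + 1 by rewrite natr1 truncnS_gt.
  rewrite -(ltr_pM2r u0) -mulrA -expRD.
  have : 1 <= expR (n%:R * s + - n%:R * x).
    by rewrite -expR0 ler_expR mulNr -mulrBr mulr_ge0// subr_ge0.
  nra.
have : (1 - u) ^+ N <= expR (- (N%:R * u)).
  rewrite -mulrN expRM_natl; apply: lerXn2r; rewrite ?nnegrE ?subr_ge0 ?expR_ge0//.
  exact: expR_ge1Dx.
move=> /le_trans; apply; rewrite expRN lef_pV2 ?posrE ?expR_gt0//.
have := expR_ge1Dx (N%:R * u); lra.
Qed.

Lemma threshold_cvg s x : 0 <= x ->
  threshold s n x @[n --> \oo] --> (\1_`]s, +oo[ x : R).
Proof.
move=> x0; have inv0 := @cvg_invn R.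
rewrite indicE; case: (ltP s x) => sx.
  rewrite mem_set/= ?in_itv/= ?andbT//.
  apply: (@squeeze_cvgr _ _ _ _ (fun n => 1 - 4 / (n%:R * (x - s) ^+ 2)) (cst 1)).
  - near=> n; rewrite threshold_le1// threshold_ge//=; near: n; by exists 1%N.
  - rewrite -[X in _ --> X]subr0; apply: cvgB; first exact: cvg_cst.
    rewrite -(mulr0 (4 / (x - s) ^+ 2)).
    rewrite (_ : (fun n => _) = (fun n => 4 / (x - s) ^+ 2 * n%:R^-1)); last first.
      by apply/funext => n; rewrite invfM mulrA mulrAC.
    by apply: cvgM => //; exact: cvg_cst.
  - exact: cvg_cst.
rewrite memNset/= ?in_itv/= ?andbT; last by apply/negP; rewrite -leNgt.
apply: (@squeeze_cvgr _ _ _ _ (cst 0) (fun n => n%:R^-1)) => //.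
- near=> n; rewrite threshold_ge0// threshold_le//; near: n; by exists 1%N.
- exact: cvg_cst.
Unshelve. all: by end_near. Qed.

Lemma measurable_threshold D s n : measurable_fun D (threshold s n).
Proof.
rewrite /threshold; apply: measurable_funX; apply: measurable_funB => //.
exact: measurable_expRM.
Qed.

Lemma integral_threshold_cvg mu s :
  (\int[mu]_(x in Rp) (threshold s n x)%:E @[n --> \oo] --> mu (`]s, +oo[ `&` Rp))%E.
Proof.
have [|||||_ _] := @dominated_convergence _ _ _ mu Rp (measurable_itv _)
  (fun n x => (threshold s n x)%:E) (EFin \o \1_`]s, +oo[) (cst 1%E).
- by move=> n; apply/measurable_EFinP; exact: measurable_threshold.
- by apply/measurable_EFinP; exact: measurable_indic.
- apply: aeW => x; rewrite /= in_itv/= andbT => x0.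
  by apply: cvg_EFin; [exact: nearW|exact: threshold_cvg].
- exact: finite_measure_integrable_cst.
- apply: aeW => x n; rewrite /= in_itv/= andbT => x0.
  by rewrite lee_fin ger0_norm ?threshold_ge0 ?threshold_le1.
by rewrite integral_indic.
Qed.

Lemma integrable_expR_law mu l : 0 <= l ->
  mu.-integrable Rp (fun x => (expR (- l * x))%:E).
Proof.
move=> l0; apply: (@le_integrable _ _ _ mu Rp (measurable_itv _) _ (cst 1%E)).
- by apply/measurable_EFinP; exact: measurable_expRM.
- move=> x; rewrite /= in_itv/= andbT => x0.
  by rewrite normr1 lee_fin ger0_norm ?expR_ge0// -expR0 ler_expR mulNr oppr_le0 mulr_ge0.
- exact: finite_measure_integrable_cst.
Qed.

(** The weight e^{-lx} with l free is what makes the induction on [N] go through: one more factor 1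
    - e^{-nx} gives the difference of the integrals at l and at l + n. *)
Lemma integral_expR_power mu1 mu2 : nonneg_law mu1 -> nonneg_law mu2 ->
  (forall l, 0 <= l -> laplace mu1 l = laplace mu2 l) ->
  forall N (n : nat) l, 0 <= l ->
  (\int[mu1]_(x in Rp) (expR (- l * x) * (1 - expR (- n%:R * x)) ^+ N)%:E =
   \int[mu2]_(x in Rp) (expR (- l * x) * (1 - expR (- n%:R * x)) ^+ N)%:E)%E.
Proof.
move=> mu10 mu20 L12 N n; elim: N => [l l0|N IH l l0].
  under eq_integral do rewrite expr0 mulr1.
  under [in RHS]eq_integral do rewrite expr0 mulr1.
  have := L12 _ l0; rewrite /laplace !nonneg_law_integral//.
  - by apply/measurable_EFinP; exact: measurable_expRM.
  - by apply/measurable_EFinP; exact: measurable_expRM.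
have int mu l' : 0 <= l' -> mu.-integrable Rp
    (fun x => (expR (- l' * x) * (1 - expR (- n%:R * x)) ^+ N)%:E).
  move=> l'0; apply: le_integrable (integrable_expR_law mu l'0) => //.
    apply/measurable_EFinP; apply: measurable_funM; first exact: measurable_expRM.
    apply: measurable_funX; apply: measurable_funB => //; exact: measurable_expRM.
  move=> x; rewrite /= in_itv/= andbT => x0; rewrite lee_fin normrM ler_piMr//.
  have e1 : expR (- n%:R * x) <= 1 by rewrite -expR0 ler_expR mulNr oppr_le0 mulr_ge0.
  rewrite ger0_norm ?exprn_ge0 ?subr_ge0// exprn_ile1 ?subr_ge0//.
have E mu : (\int[mu]_(x in Rp) (expR (- l * x) * (1 - expR (- n%:R * x)) ^+ N.+1)%:E =
    \int[mu]_(x in Rp) (expR (- l * x) * (1 - expR (- n%:R * x)) ^+ N)%:E -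
    \int[mu]_(x in Rp) (expR (- (l + n%:R) * x) * (1 - expR (- n%:R * x)) ^+ N)%:E)%E.
  rewrite -integralB//; [|exact: int|by apply: int; rewrite addr_ge0].
  apply: eq_integral => x _; rewrite -EFinB; congr EFin.
  have -> : - (l + n%:R) * x = - l * x + - n%:R * x by ring.
  by rewrite exprS expRD; ring.
by rewrite !E !IH// addr_ge0.
Qed.

(** The integrals of [threshold s n] agree for all n, and their limits are the masses of the rays
    above s. These rays form a pi-system generating the Borel sets. *)
Lemma laplace_inj mu1 mu2 : nonneg_law mu1 -> nonneg_law mu2 ->
  (forall l, 0 <= l -> laplace mu1 l = laplace mu2 l) ->
  forall A, measurable A -> mu1 A = mu2 A.
Proof.
move=> mu10 mu20 L12.
have rayE s : mu1 `]s, +oo[%classic = mu2 `]s, +oo[%classic.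
  have H mu : nonneg_law mu -> mu `]s, +oo[%classic = mu (`]s, +oo[%classic `&` Rp).
    move=> mu0; rewrite -[in LHS](setIT `]s, +oo[%classic) -(setUv Rp) setIUr measureU//.
    - rewrite [X in (_ + X)%E](_ : _ = 0%E) ?adde0//.
      apply/eqP; rewrite -measure_le0 -mu0 setCitvr; apply: le_measure; rewrite ?inE//.
        by apply: measurableI.
    - exact: measurableI.
    - by apply: measurableI => //; exact: measurableC.
    - by rewrite setIACA setICr setI0.
  rewrite !H//.
  have E n : (\int[mu1]_(x in Rp) (threshold s n x)%:E =
              \int[mu2]_(x in Rp) (threshold s n x)%:E)%E.
    have e x : threshold s n x = expR (- 0 * x) * threshold s n x.
      by rewrite oppr0 mul0r expR0 mul1r.
    under eq_integral do rewrite e; under [in RHS]eq_integral do rewrite e.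
    exact: integral_expR_power.
  have := @integral_threshold_cvg mu1 s; under eq_fun do rewrite E.
  by move=> /cvg_lim <- //; apply/cvg_lim => //; exact: integral_threshold_cvg.
move=> A; rewrite /measurable/= /measurableR RGenOInfty.measurableE => mA.
apply: (@g_sigma_algebra_measure_unique _ _ _ (@RGenOInfty.G R) _
  (fun k => `]- k%:R, +oo[%classic)) => //.
- by move=> _ [x ->]; exact: measurable_itv.
- by move=> k; exists (- k%:R).
- apply/seteqP; split=> // x _; exists (Num.truncn (- x)).+1 => //=.
  by rewrite in_itv/= andbT ltrNl truncnS_gt.
- move=> _ _ [x ->] [y ->]; exists (Num.max x y).
  by apply/seteqP; split => z /=; rewrite !in_itv/= !andbT gt_max => /andP.
- by move=> _ [x ->]; exact: rayE.
- by move=> k; rewrite (le_lt_trans (probability_le1 _ _))// ltry.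
Qed.

End laplace_uniqueness.

(** * Densities and compound Poisson laws *)

Section density.
Local Open Scope ereal_scope.
Context d (T : measurableType d) (R : realType).
Variables (mu : {measure set T -> \bar R}) (g : T -> R).
Hypotheses (mg : measurable_fun [set: T] g) (g0 : forall x, (0 <= g x)%R).

Definition with_density (A : set T) : \bar R := \int[mu]_(x in A) (g x)%:E.

Let mEg : measurable_fun [set: T] (EFin \o g).
Proof. exact/measurable_EFinP. Qed.

Let with_density0 : with_density set0 = 0.
Proof. by rewrite /with_density integral_set0. Qed.

Let with_density_ge0 A : 0 <= with_density A.
Proof. by apply: integral_ge0 => x _; rewrite lee_fin. Qed.

Let with_density_sigma_additive : semi_sigma_additive with_density.
Proof. by apply: semi_sigma_additive_nng_induced => // x; rewrite lee_fin. Qed.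

HB.instance Definition _ := isMeasure.Build _ _ _ with_density
  with_density0 with_density_ge0 with_density_sigma_additive.

Import HBNNSimple.

(** Monotone convergence along simple functions, on both sides, leaves finite sums of indicators,
    for which the identity is the definition of the measure. *)
Lemma integral_with_density (f : T -> \bar R) : measurable_fun [set: T] f ->
  (forall x, 0 <= f x) ->
  \int[with_density]_x f x = \int[mu]_x (f x * (g x)%:E).
Proof.
move=> mf f0; pose h := nnsfun_approx measurableT mf.
have fE x : f x = lim ((EFin \o h n) x @[n --> \oo]).
  by apply/esym/cvg_lim => //; exact: cvg_nnsfun_approx.
have -> : \int[with_density]_x f x =
    lim (\int[with_density]_x (EFin \o h n) x @[n --> \oo]).
  under eq_integral => x _ do rewrite fE.
  apply: monotone_convergence => //.
  - by move=> n; apply/measurable_EFinP; exact/measurable_funP.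
  - by move=> n x _ //=; rewrite lee_fin.
  - by move=> x _ a b ab; rewrite lee_fin; exact/lefP/nd_nnsfun_approx.
have -> : \int[mu]_x (f x * (g x)%:E) =
    lim (\int[mu]_x ((EFin \o h n) x * (g x)%:E) @[n --> \oo]).
  have fg x : f x * (g x)%:E = lim ((EFin \o h n) x * (g x)%:E @[n --> \oo]).
    by apply/esym/cvg_lim => //; apply: cvgeZr => //; exact: cvg_nnsfun_approx.
  under eq_integral => x _ do rewrite fg.
  apply: monotone_convergence => //.
  - by move=> n; apply/emeasurable_funM => //; exact/measurable_EFinP.
  - by move=> n x _ /=; rewrite mule_ge0 ?lee_fin.
  - by move=> x _ a b ab/=; rewrite lee_wpmul2r ?lee_fin//; exact/lefP/nd_nnsfun_approx.
congr (limn _); apply/funext => n.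
transitivity (\int[with_density]_x
   (\sum_(y \in range (h n)) (y * \1_(h n @^-1` [set y]) x)%:E)).
  by apply: eq_integral => t tE; rewrite /= fimfunE -fsumEFin.
have indich r : measurable_fun [set: T] (fun x => (r * \1_(h n @^-1` [set r]) x)%:E).
  by apply: (measurable_comp measurableT) => //; exact: measurable_funM.
rewrite ge0_integral_fsum//; last by move=> m y Ey; exact: nnfun_muleindic_ge0.
transitivity (\int[mu]_x (\sum_(y \in range (h n))
    (y * \1_(h n @^-1` [set y]) x)%:E * (g x)%:E)); last first.
  under eq_integral => x xE.
    rewrite -ge0_mule_fsuml => [|y]; last exact: nnfun_muleindic_ge0.
    rewrite fsumEFin // -(fimfunE _ x); over.
  by [].
rewrite ge0_integral_fsum//; last 2 first.
  - by move=> y; apply: emeasurable_funM.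
  - by move=> m y Ey; apply: mule_ge0; [exact: nnfun_muleindic_ge0|rewrite lee_fin].
apply: eq_fsbigr => r rhn.
under [LHS]eq_integral do rewrite EFinM.
rewrite integralZl_indic_nnsfun => //.
rewrite integral_indic// setIT.
under [RHS]eq_integral do rewrite EFinM -muleA.
have r0 : (0 <= r)%R by move: rhn; rewrite inE => -[x _ <-].
rewrite ge0_integralZl_EFin//.
- congr (_ * _).
  transitivity (\int[mu]_(x in h n @^-1` [set r]) (g x)%:E) => //.
  rewrite integral_mkcond; apply: eq_integral => x _; rewrite patchE indicE.
  by case: ifPn => _; rewrite ?mul1e ?mul0e.
- by move=> x _; rewrite mule_ge0 ?lee_fin.
- by apply: emeasurable_funM => //; exact/measurable_EFinP.
Qed.

Hypothesis g1 : \int[mu]_x (g x)%:E = 1.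

HB.instance Definition _ := Measure_isProbability.Build _ _ _ with_density g1.

Lemma density_probability : exists P : probability T R,
  (forall A, P A = \int[mu]_(x in A) (g x)%:E) /\
  (forall f : T -> \bar R, measurable_fun [set: T] f -> (forall x, 0 <= f x) ->
    \int[P]_x f x = \int[mu]_x (f x * (g x)%:E)).
Proof. by exists with_density; split => //; exact: integral_with_density. Qed.

End density.

Section laws.
Variable R : realType.
Local Notation leb := (@lebesgue_measure R).
Implicit Types (mu nu : probability R R).

(** The identity, typed so as to push a law forward from the measurable space that carries Lebesgue
    measure to the one used in [probability R R]. *)
Definition id_measurableTypeR : measurableTypeR R -> R := idfun.

HB.instance Definition _ := @isMeasurableFun.Build _ _ _ _
  id_measurableTypeR (@measurable_id _ _ setT).

Lemma density_law (g : R -> R) : measurable_fun [set: R] g ->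
  (forall x, 0 <= g x) -> (forall x, x < 0 -> g x = 0) ->
  (\int[leb]_x (g x)%:E = 1)%E ->
  exists2 nu : probability R R, nonneg_law nu &
    forall l, laplace nu l = (\int[leb]_x (expR (- l * x) * g x)%:E)%E.
Proof.
move=> mg g0 gneg g1.
have [P [PA Pf]] := @density_probability _ (measurableTypeR R) R leb g mg g0 g1.
exists (distribution P id_measurableTypeR).
  rewrite /nonneg_law [LHS]PA (eq_integral (cst 0%E)) ?integral0// => x.
  by rewrite inE/= in_itv/= => /gneg ->.
move=> l; rewrite /laplace ge0_integral_distribution.
- rewrite Pf//.
  + by apply/measurable_EFinP; apply: measurableT_comp => //; exact: measurable_funM.
  + by move=> x; rewrite lee_fin expR_ge0.
- by apply/measurable_EFinP; apply: measurableT_comp => //; exact: measurable_funM.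
- by move=> x; rewrite lee_fin expR_ge0.
Qed.

Definition affine_sum (c : R) (p : R * R) : R := c * p.1 + p.2.

Lemma measurable_affine_sum c : measurable_fun [set: R * R] (affine_sum c).
Proof. by apply: measurable_funD => //; apply: measurable_funM. Qed.

HB.instance Definition _ c :=
  isMeasurableFun.Build _ _ _ _ (affine_sum c) (measurable_affine_sum c).

(** The law of cX + V with X and V independent. It unfolds to the right-hand side of
    [selfdecomposable], and c = 1 gives convolution. *)
Definition affine_law c mu nu : probability R R :=
  distribution (mu \x nu)%E (affine_sum c).

Lemma laplace_affine_law c mu nu l :
  laplace (affine_law c mu nu) l = (laplace mu (c * l) * laplace nu l)%E.
Proof.
have me k (D : set R) : measurable_fun D (fun x : R => (expR (- k * x))%:E).
  by apply/measurable_EFinP; apply: measurableT_comp => //; exact: measurable_funM.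
rewrite /laplace ge0_integral_distribution//.
rewrite fubini_tonelli1//=; last first.
  apply/measurable_EFinP; apply: measurableT_comp => //.
  by apply: measurable_funM => //; exact: measurable_affine_sum.
have E x : (\int[nu]_y (expR (- l * affine_sum c (x, y)))%:E =
            (expR (- (c * l) * x))%:E * \int[nu]_y (expR (- l * y))%:E)%E.
  rewrite -ge0_integralZl//.
  apply: eq_integral => y _; rewrite -EFinM -expRD /affine_sum/=.
  by congr (expR _)%:E; ring.
rewrite (eq_integral _ _ (fun x _ => E x)).
rewrite ge0_integralZr//.
by apply: integral_ge0 => x _; rewrite lee_fin expR_ge0.
Qed.

Lemma affine_law_nonneg c mu nu : 0 <= c ->
  nonneg_law mu -> nonneg_law nu -> nonneg_law (affine_law c mu nu).
Proof.
move=> c0 mu0 nu0; rewrite /nonneg_law; set N := `]-oo, 0[%classic.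
have mN : measurable N by exact: measurable_itv.
have h1 : (mu \x nu)%E (N `*` setT) = 0%E.
  by rewrite product_measure1E//; apply/eqP; rewrite mule_eq0; apply/orP; left; apply/eqP.
have h2 : (mu \x nu)%E (setT `*` N) = 0%E.
  by rewrite product_measure1E//; apply/eqP; rewrite mule_eq0; apply/orP; right; apply/eqP.
apply/eqP; rewrite -measure_le0/=.
apply: (@le_trans _ _ ((mu \x nu)%E (N `*` setT `|` setT `*` N))).
  apply: le_measure; rewrite ?inE.
  - rewrite -[X in measurable X]setTI; exact: measurable_affine_sum.
  - by apply: measurableU; exact: measurableX.
  - move=> [x y]; rewrite /affine_sum /N/= !in_itv/= => xy.
    have [x0|x0] := ltP x 0; [by left|right; split=> //].
    by rewrite (le_lt_trans _ xy)// lerDr mulr_ge0.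
rewrite -(adde0 0%E) -{1}h1 -h2.
by apply: measureU2; exact: measurableX.
Qed.

Lemma laplace_dirac0 l : laplace (\d_(0 : R) : probability R R) l = 1%E.
Proof.
rewrite /laplace integral_dirac//.
  by rewrite diracT mul1e mulr0 expR0.
by apply/measurable_EFinP; apply: measurableT_comp => //; exact: measurable_funM.
Qed.

End laws.

(** * Compound Poisson laws as Poisson mixtures of convolution powers *)

Section compound_poisson.
Variable R : realType.
Implicit Types (M : {nonneg R}) (rho : probability R R).

Fixpoint convolution_power rho n : probability R R :=
  if n is n'.+1 then affine_law 1 rho (convolution_power rho n') else \d_(0 : R).

Lemma dirac0_nonneg : nonneg_law (\d_(0 : R) : probability R R).
Proof. by rewrite /nonneg_law/= /dirac indicE memNset//= in_itv/= ltxx. Qed.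

Lemma convolution_power_nonneg rho n :
  nonneg_law rho -> nonneg_law (convolution_power rho n).
Proof.
move=> rho0; elim: n => [|n IH] /=; first exact: dirac0_nonneg.
exact: affine_law_nonneg.
Qed.

Lemma laplace_convolution_power rho n l v : laplace rho l = v%:E ->
  laplace (convolution_power rho n) l = (v ^+ n)%:E.
Proof.
move=> rhov; elim: n => [|n IH] /=; first exact: laplace_dirac0.
by rewrite laplace_affine_law mul1r IH rhov -EFinM exprS.
Qed.

Lemma poisson_weight_ge0 M n : 0 <= M%:num ^+ n / n`!%:R * expR (- M%:num).
Proof. by rewrite mulr_ge0 ?expR_ge0// divr_ge0// exprn_ge0. Qed.

Definition poisson_weight M n : {nonneg R} := NngNum (poisson_weight_ge0 M n).

Lemma eseries_expR (x : R) : 0 <= x ->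
  (\sum_(n <oo) (x ^+ n / n`!%:R)%:E = (expR x)%:E)%E.
Proof.
move=> x0; rewrite expRE -EFin_lim; last first.
  rewrite /pseries/=; under eq_fun do rewrite mulrC.
  exact: is_cvg_series_exp_coeff.
apply/congr_lim/funext => n/=; rewrite /pseries/= /series/= -sumEFin//.
by under eq_bigr do rewrite mulrC.
Qed.

Definition compound_poisson M rho : set R -> \bar R :=
  mseries (fun n => mscale (poisson_weight M n) (convolution_power rho n)) 0.

HB.instance Definition _ M rho := Measure.on (compound_poisson M rho).

Lemma eseries_poisson_weight M (v : R) : 0 <= v ->
  (\sum_(n <oo) (poisson_weight M n)%:num%:E * (v ^+ n)%:E =
   (expR (M%:num * (v - 1)))%:E)%E.
Proof.
move=> v0; rewrite mulrBr mulr1 addrC expRD EFinM.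
rewrite -(@eseries_expR (M%:num * v)) ?mulr_ge0// -nneseriesZl//; last first.
  by move=> n _; rewrite lee_fin divr_ge0// exprn_ge0// mulr_ge0.
apply: eq_eseriesr => n _; rewrite -!EFinM/= exprMn.
by congr EFin; ring.
Qed.

Let compound_poisson_setT M rho : compound_poisson M rho setT = 1%E.
Proof.
transitivity ((\sum_(n <oo) (poisson_weight M n)%:num%:E * (1 ^+ n)%:E)%E : \bar R).
  apply: eq_eseriesr => n _.
  by rewrite expr1n; congr (_ * _)%E; exact: probability_setT.
by rewrite eseries_poisson_weight// subrr mulr0 expR0.
Qed.

HB.instance Definition _ M rho :=
  Measure_isProbability.Build _ _ _ (compound_poisson M rho)
    (compound_poisson_setT M rho).

Lemma compound_poisson_nonneg M rho :
  nonneg_law rho -> nonneg_law (compound_poisson M rho).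
Proof.
move=> rho0; rewrite /nonneg_law/= /compound_poisson/= /mseries.
rewrite eseries0// => n _ _; rewrite /mscale/=.
by apply/eqP; rewrite mule_eq0; apply/orP; right; apply/eqP; exact: convolution_power_nonneg.
Qed.

Lemma laplace_compound_poisson M rho l v : laplace rho l = v%:E ->
  laplace (compound_poisson M rho) l = (expR (M%:num * (v - 1)))%:E.
Proof.
move=> rhov.
have me : measurable_fun [set: R] (fun x : R => (expR (- l * x))%:E).
  by apply/measurable_EFinP; exact: measurable_expRM.
have v0 : 0 <= v.
  by rewrite -lee_fin -rhov; apply: integral_ge0 => x _; rewrite lee_fin expR_ge0.
rewrite -eseries_poisson_weight// /laplace ge0_integral_measure_series//.
  apply: eq_eseriesr => n _; rewrite ge0_integral_mscale//.
    by rewrite -(laplace_convolution_power n rhov).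
Qed.

End compound_poisson.

Section levy_density.
Variable R : realType.
Local Notation leb := (@lebesgue_measure R).

(** A compound Poisson law of intensity M and jump density m / M. If M = 0 this normalisation is
    impossible, and the law is the Dirac mass at 0. *)
Lemma finite_levy_law (m : R -> R) (M : R) : measurable_fun [set: R] m ->
  (forall x, 0 <= m x) -> (forall x, x < 0 -> m x = 0) ->
  (\int[leb]_x (m x)%:E = M%:E)%E ->
  exists2 nu : probability R R, nonneg_law nu &
    forall l v, 0 <= l -> (\int[leb]_x (expR (- l * x) * m x)%:E = v%:E)%E ->
      laplace nu l = (expR (v - M))%:E.
Proof.
move=> mm m0 mneg mM.
have M0 : 0 <= M by rewrite -lee_fin -mM integral_ge0// => x _; rewrite lee_fin.
have [Mz|Mp] := eqVneq M 0.
  exists (\d_(0 : R) : probability R R); first exact: dirac0_nonneg.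
  move=> l v l0 mv; rewrite laplace_dirac0; suff -> : v = 0 by rewrite Mz subrr expR0.
  apply/eqP; rewrite eq_le -!lee_fin -{1}Mz -mM -mv; apply/andP; split.
    apply: ge0_le_integral => //.
    - by move=> x _; rewrite lee_fin mulr_ge0// expR_ge0.
    - by apply/measurable_EFinP; apply: measurable_funM => //; exact: measurable_expRM.
    - exact/measurable_EFinP.
    - move=> x _; rewrite lee_fin; have [x0|x0] := ltP x 0.
        by rewrite mneg// mulr0.
      by rewrite ler_piMl// -expR0 ler_expR mulNr oppr_le0 mulr_ge0.
  by apply: integral_ge0 => x _; rewrite lee_fin mulr_ge0// expR_ge0.
have {}Mp : 0 < M by rewrite lt_def Mp.
have [|x|x xneg||rho rho0 rhoL] := @density_law R (fun x => M^-1 * m x).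
- exact: measurable_funM.
- by rewrite mulr_ge0// invr_ge0.
- by rewrite mneg ?mulr0.
- under eq_integral do rewrite EFinM.
  rewrite ge0_integralZl//.
  + by rewrite mM -EFinM mulVf ?gt_eqF.
  + exact/measurable_EFinP.
  + by move=> x _; rewrite lee_fin.
  + by rewrite lee_fin invr_ge0.
exists (compound_poisson (NngNum M0) rho); first exact: compound_poisson_nonneg.
move=> l v l0 mv; rewrite (@laplace_compound_poisson _ _ _ _ (M^-1 * v)).
  by congr (expR _)%:E; rewrite /= mulrBr mulrA divff ?gt_eqF// mul1r mulr1.
rewrite rhoL EFinM -mv -ge0_integralZl//.
- by apply: eq_integral => x _; rewrite -EFinM; congr EFin; ring.
- by apply/measurable_EFinP; apply: measurable_funM => //; exact: measurable_expRM.
- by move=> x _; rewrite lee_fin mulr_ge0// expR_ge0.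
- by rewrite lee_fin invr_ge0.
Qed.

End levy_density.

(** * Integrals over the positive half-line *)

Section calculus.
Variable R : realType.
Local Notation leb := (@lebesgue_measure R).
Implicit Types (f F df : R -> R) (a b x : R).

Lemma is_derive_continuous f x l : is_derive x 1 f l -> {for x, continuous f}.
Proof.
by move=> df; apply/differentiable_continuous/derivable1_diffP; exact: ex_derive.
Qed.

Lemma le_of_derive f df a b : a <= b ->
  (forall x, a <= x <= b -> is_derive x 1 f (df x)) ->
  (forall x, a <= x <= b -> 0 <= df x) -> f a <= f b.
Proof.
move=> ab fdf df0.
have [x||c cab fE] := @MVT_segment R f df a b ab.
- by rewrite in_itv/= => /andP[ax xb]; apply: fdf; rewrite !ltW.
- apply: derivable_within_continuous => x; rewrite in_itv/= => /fdf dfx.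
  exact: ex_derive.
- by rewrite -subr_ge0 fE mulr_ge0 ?subr_ge0// df0//; rewrite in_itv/= in cab.
Qed.

Lemma integral_FTC f F a b : a < b ->
  (forall x, a <= x <= b -> is_derive x 1 F (f x)) ->
  (forall x, a <= x <= b -> {for x, continuous f}) ->
  (\int[leb]_(x in `[a, b]) (f x)%:E = (F b - F a)%:E)%E.
Proof.
move=> ab Ff cf; have Fc : {within `[a, b], continuous F}.
  apply: derivable_within_continuous => x; rewrite in_itv/= => /Ff dfx.
  exact: ex_derive.
rewrite (@continuous_FTC2 _ f F)//.
- apply: continuous_in_subspaceT => x; rewrite inE/= in_itv/=; exact: cf.
- have [cm ca cb] := (continuous_within_itvP F ab).1 Fc.
  split => // x; rewrite in_itv/= => /andP[ax xb].
  by have := Ff x; rewrite !ltW// => /(_ isT) ?; exact: ex_derive.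
- move=> x; rewrite in_itv/= => /andP[ax xb].
  by have := Ff x; rewrite !ltW// => /(_ isT) ?; rewrite derive1E derive_val.
Qed.

Lemma integral_expR_itv0y a : 0 < a ->
  (\int[leb]_(x in `]0%R, +oo[) (expR (- a * x))%:E = (a^-1)%:E)%E.
Proof.
move=> a0; rewrite integral_itv_obnd_cbnd; last first.
  by apply/measurable_EFinP; apply: measurableT_comp => //; exact: measurable_funM.
have dF x : is_derive x 1 (fun x => - a^-1 * expR (- a * x)) (expR (- a * x)).
  apply: is_derive_eq; rewrite /GRing.scale/=.
  by field; rewrite gt_eqF.
rewrite (@ge0_continuous_FTC2y _ _ (fun x => - a^-1 * expR (- a * x)) 0 0).
- by rewrite mulr0 expR0 mulr1 EFinN oppeK add0e.
- by move=> x _; exact: expR_ge0.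
- apply: continuous_subspaceT => x.
  apply: continuous_comp; last exact: continuous_expR.
  by apply: cvgM; [exact: cvg_cst|exact: cvg_id].
- rewrite -(mulr0 (- a^-1)); apply: cvgM; first exact: cvg_cst.
  rewrite (_ : (fun x => _) = (fun x => expR (- x)) \o (fun x => a * x)); last first.
    by apply/funext => x /=; rewrite mulNr.
  by apply: cvg_comp; [apply: gt0_cvgMry|exact: cvgr_expR].
- by move=> x _; exact: ex_derive.
- by apply: cvg_at_right_filter; exact: is_derive_continuous (dF 0).
- by move=> x _; rewrite derive1E derive_val.
Qed.

End calculus.

Section tonelli.
Local Open Scope ereal_scope.
Variable R : realType.
Local Notation leb := (@lebesgue_measure R).

Lemma tonelli_sets (D1 D2 : set R) (f : R -> R -> \bar R) :
  measurable D1 -> measurable D2 ->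
  measurable_fun [set: R * R] (fun p : R * R => f p.1 p.2) ->
  (forall x y, D1 x -> D2 y -> 0 <= f x y) ->
  \int[leb]_(x in D1) \int[leb]_(y in D2) f x y =
  \int[leb]_(y in D2) \int[leb]_(x in D1) f x y.
Proof.
move=> mD1 mD2 mf f0.
pose F (p : R * R) := f p.1 p.2 * (\1_D1 p.1)%:E * (\1_D2 p.2)%:E.
have mF : measurable_fun [set: R * R] F.
  apply: emeasurable_funM; first apply: emeasurable_funM => //.
  - by apply/measurable_EFinP; apply: measurableT_comp => //; exact: measurable_indic.
  - by apply/measurable_EFinP; apply: measurableT_comp => //; exact: measurable_indic.
have F0 p : 0 <= F p.
  rewrite /F !indicE; have [/set_mem p1|] := boolP (p.1 \in D1); last by rewrite mule0 mul0e.
  have [/set_mem p2|] := boolP (p.2 \in D2); last by rewrite mule0.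
  by rewrite !mule1 f0.
have := @fubini_tonelli _ _ _ _ R leb leb F mF F0.
have -> : \int[leb]_x \int[leb]_y F (x, y) = \int[leb]_(x in D1) \int[leb]_(y in D2) f x y.
  rewrite [RHS]integral_mkcond; apply: eq_integral => x _; rewrite patchE.
  case: ifPn => xD1.
    rewrite [RHS]integral_mkcond; apply: eq_integral => y _; rewrite patchE.
    by rewrite /F/= !indicE xD1 mule1; case: ifPn => _; rewrite ?mule1 ?mule0.
  rewrite -[RHS](integral0 leb setT); apply: eq_integral => y _.
  by rewrite /F/= !indicE (negbTE xD1) mule0 mul0e.
have -> : \int[leb]_y \int[leb]_x F (x, y) = \int[leb]_(y in D2) \int[leb]_(x in D1) f x y.
  rewrite [RHS]integral_mkcond; apply: eq_integral => x _; rewrite patchE.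
  case: ifPn => xD2.
    rewrite [RHS]integral_mkcond; apply: eq_integral => y _; rewrite patchE.
    by rewrite /F/= !indicE xD2 mule1; case: ifPn => _; rewrite ?mule1 ?mule0.
  rewrite -[RHS](integral0 leb setT); apply: eq_integral => y _.
  by rewrite /F/= !indicE (negbTE xD2) mule0.
by [].
Qed.

End tonelli.

(** * Convergent integrals with their values, and Frullani integrals *)

Section has_integral.
Variable R : realType.
Local Notation leb := (@lebesgue_measure R).
Local Notation Rp := (`]0, +oo[%classic : set R).
Implicit Types (f g : R -> R) (a b l u v x k : R).

(** Integrability is bundled with the value, so that integrals can be added, scaled and compared
    with no separate integrability proofs. *)
Definition has_integral f v :=
  leb.-integrable Rp (EFin \o f) /\ (\int[leb]_(x in Rp) (f x)%:E = v%:E)%E.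

Lemma has_integral_ext f g v : (forall x, 0 < x -> f x = g x) ->
  has_integral f v -> has_integral g v.
Proof.
move=> fg [fi fv]; have fgRp x : x \in Rp -> (f x)%:E = (g x)%:E.
  by rewrite inE/= in_itv/= andbT => /fg ->.
split; first by apply: eq_integrable fi => // x /fgRp.
by rewrite -fv; apply: eq_integral => x /fgRp.
Qed.

Lemma has_integralD f g u v : has_integral f u -> has_integral g v ->
  has_integral (fun x => f x + g x) (u + v).
Proof.
move=> [fi fv] [gi gv]; split.
  by have := @integrableD _ _ _ leb Rp (measurable_itv _) _ _ fi gi.
by under eq_integral do rewrite EFinD; rewrite integralD_EFin// fv gv.
Qed.

Lemma has_integralB f g u v : has_integral f u -> has_integral g v ->
  has_integral (fun x => f x - g x) (u - v).
Proof.
move=> [fi fv] [gi gv]; split.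
  by have := @integrableB _ _ _ leb Rp (measurable_itv _) _ _ fi gi.
by under eq_integral do rewrite EFinB; rewrite integralB_EFin// fv gv.
Qed.

Lemma has_integralZ k f u : has_integral f u -> has_integral (fun x => k * f x) (k * u).
Proof.
move=> [fi fv]; split.
  by have := @integrableZl _ _ _ leb Rp (measurable_itv _) k _ fi.
by under eq_integral do rewrite EFinM; rewrite integralZl// fv.
Qed.

Lemma has_integral_ge0 f v : measurable_fun Rp f -> (forall x, 0 < x -> 0 <= f x) ->
  (\int[leb]_(x in Rp) (f x)%:E = v%:E)%E -> has_integral f v.
Proof.
move=> mf f0 fv; split => //; apply/integrableP; split; first exact/measurable_EFinP.
have -> : (\int[leb]_(x in Rp) `|(EFin \o f) x| = \int[leb]_(x in Rp) (f x)%:E)%E.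
  by apply: eq_integral => x; rewrite inE/= in_itv/= andbT => x0; rewrite ger0_norm ?f0.
by rewrite fv ltry.
Qed.

Lemma has_integral_le f g u v : (forall x, 0 < x -> f x <= g x) ->
  has_integral f u -> has_integral g v -> u <= v.
Proof.
move=> fg [fi fv] [gi gv]; rewrite -lee_fin -fv -gv; apply: le_integral => // x.
by rewrite inE/= in_itv/= andbT => /fg; rewrite lee_fin.
Qed.

Lemma has_integral_dominated f g v : measurable_fun Rp f ->
  (forall x, 0 < x -> `|f x| <= g x) -> has_integral g v ->
  has_integral f (\int[leb]_(x in Rp) f x).
Proof.
move=> mf fg [gi gv]; have fi : leb.-integrable Rp (EFin \o f).
  apply: le_integrable gi => //; first exact/measurable_EFinP.
  move=> x; rewrite /= in_itv/= andbT => /fg; rewrite lee_fin => /le_trans; apply.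
  exact: ler_norm.
by split => //; rewrite /Rintegral fineK//; exact: integrable_fin_num.
Qed.

Lemma has_integral_unique f u v : has_integral f u -> has_integral f v -> u = v.
Proof. by move=> [_ fu] [_ fv]; apply: EFin_inj; rewrite -fu. Qed.

Lemma has_integral_expR a : 0 < a -> has_integral (fun x => expR (- a * x)) a^-1.
Proof.
move=> a0; apply: has_integral_ge0; first exact: measurable_expRM.
  by move=> x _; exact: expR_ge0.
exact: integral_expR_itv0y.
Qed.

Lemma integral_expR_exponent a b x : a <= b -> 0 < x ->
  (\int[leb]_(u in `[a, b]) (expR (- u * x))%:E =
   ((expR (- a * x) - expR (- b * x)) / x)%:E)%E.
Proof.
rewrite le_eqVlt => /predU1P[->|ab] x0.
  by rewrite set_itv1 integral_set1 subrr mul0r.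
have d u : a <= u <= b -> is_derive u 1 (fun u => - x^-1 * expR (- u * x)) (expR (- u * x)).
  by move=> _; apply: is_derive_eq; rewrite /GRing.scale/=; field; rewrite gt_eqF.
have c u : a <= u <= b -> {for u, continuous (fun u => expR (- u * x))}.
  move=> _; apply: is_derive_continuous (_ : is_derive u 1 _ (- x * expR (- u * x))).
  by apply: is_derive_eq; rewrite /GRing.scale/=; ring.
by rewrite (integral_FTC ab d c); congr EFin; ring.
Qed.

Lemma measurable_inv_pos : measurable_fun Rp (fun x => x^-1).
Proof.
apply: (eq_measurable_fun (fun x => x `^ (- 1))).
  by move=> x; rewrite inE/= in_itv/= andbT => x0; rewrite powR_inv1// ltW.
by apply: measurable_funTS; exact: measurable_powR.
Qed.

Lemma measurable_expR_mul2 : measurable_fun [set: R * R]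
  (fun p : R * R => expR (- p.2 * p.1)).
Proof.
by apply: measurableT_comp => //; apply: measurable_funM => //; exact: measurable_funN.
Qed.

Lemma integral_inv a b : 0 < a <= b ->
  (\int[leb]_(u in `[a, b]) (u^-1)%:E = (ln b - ln a)%:E)%E.
Proof.
move=> /andP[a0]; rewrite le_eqVlt => /predU1P[->|ab].
  by rewrite set_itv1 integral_set1 subrr.
have d u : a <= u <= b -> is_derive u 1 (@ln R) u^-1.
  by move=> /andP[au _]; apply: is_derive1_ln; exact: lt_le_trans au.
have c u : a <= u <= b -> {for u, continuous (fun u : R => u^-1)}.
  by move=> /andP[au _]; apply: cvgV; [rewrite gt_eqF// (lt_le_trans a0)|exact: cvg_id].
exact: (integral_FTC ab d c).
Qed.

(** The integrand is the integral of e^{-ux} over u in [a, b]; Tonelli's theorem exchanges the two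
    integrals and leaves that of 1/u. *)
Lemma frullani a b : 0 < a <= b ->
  has_integral (fun x => (expR (- a * x) - expR (- b * x)) / x) (ln b - ln a).
Proof.
move=> /andP[a0 ab]; apply: has_integral_ge0.
- apply: measurable_funM; last exact: measurable_inv_pos.
  by apply: measurable_funB; exact: measurable_expRM.
- by move=> x x0; rewrite divr_ge0 ?(ltW x0)// subr_ge0 ler_expR ler_pM2r// lerN2.
transitivity (\int[leb]_(x in Rp) \int[leb]_(u in `[a, b]) (expR (- u * x))%:E)%E.
  apply: eq_integral => x; rewrite inE/= in_itv/= andbT => x0.
  by rewrite integral_expR_exponent.
rewrite (tonelli_sets (f := fun x u => (expR (- u * x))%:E))//; last first.
  by apply/measurable_EFinP; exact: measurable_expR_mul2.
rewrite -integral_inv ?a0//; apply: eq_integral => u.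
by rewrite inE/= in_itv/= => /andP[au _]; rewrite integral_expR_itv0y// (lt_le_trans a0).
Qed.

Lemma frullani_signed a b : 0 < a -> 0 < b ->
  has_integral (fun x => (expR (- a * x) - expR (- b * x)) / x) (ln b - ln a).
Proof.
move=> a0 b0; have [ab|/ltW ba] := leP a b; first by apply: frullani; rewrite a0.
have := has_integralZ (- 1) (@frullani b a _); rewrite b0 => /(_ ba).
by rewrite mulN1r opprB; apply: has_integral_ext => x _; ring.
Qed.

(** A Frullani integral integrated once more: averaging the previous formula, with upper parameter l
    + 1 and lower parameter u, over u in [l, l + 1] produces the 1/x^2 singularity met in Binet's
    integrand. *)
Lemma frullani_second l : 0 < l ->
  has_integral (fun x => ((expR (- l * x) - expR (- (l + 1) * x)) / x
                          - expR (- (l + 1) * x)) / x)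
               (l * ln l - l * ln (l + 1) + 1).
Proof.
move=> l0; have l1 : l < l + 1 by rewrite ltrDl.
have inner x : 0 < x -> (\int[leb]_(u in `[l, (l + 1)%R])
    ((expR (- u * x) - expR (- (l + 1) * x)) / x)%:E =
    (((expR (- l * x) - expR (- (l + 1) * x)) / x - expR (- (l + 1) * x)) / x)%:E)%E.
  move=> x0.
  have d u : l <= u <= l + 1 -> is_derive u 1
      (fun u => (- x^-1 * expR (- u * x) - u * expR (- (l + 1) * x)) / x)
      ((expR (- u * x) - expR (- (l + 1) * x)) / x).
    by move=> _; apply: is_derive_eq; rewrite /GRing.scale/=; field; rewrite gt_eqF.
  have c u : l <= u <= l + 1 ->
      {for u, continuous (fun u => (expR (- u * x) - expR (- (l + 1) * x)) / x)}.
    move=> _; apply: is_derive_continuous (_ : is_derive u 1 _ (- expR (- u * x))).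
    by apply: is_derive_eq; rewrite /GRing.scale/=; field; rewrite gt_eqF.
  by rewrite (integral_FTC l1 d c); congr EFin; field; rewrite gt_eqF.
have ge0 x u : 0 < x -> u <= l + 1 ->
    0 <= (expR (- u * x) - expR (- (l + 1) * x)) / x.
  by move=> x0 ul; rewrite divr_ge0 ?(ltW x0)// subr_ge0 ler_expR ler_pM2r// lerN2.
apply: has_integral_ge0.
- apply: measurable_funM; last exact: measurable_inv_pos.
  apply: measurable_funB; last exact: measurable_expRM.
  apply: measurable_funM; last exact: measurable_inv_pos.
  by apply: measurable_funB; exact: measurable_expRM.
- move=> x x0; rewrite -lee_fin -inner//; apply: integral_ge0 => u.
  by rewrite /= in_itv/= => /andP[_ ul]; rewrite lee_fin ge0.
(* The real power of exponent -1 replaces the inverse because it is known to be measurable on the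
   whole line, and Tonelli's theorem asks for joint measurability everywhere. *)
transitivity (\int[leb]_(x in Rp) \int[leb]_(u in `[l, (l + 1)%R])
    ((expR (- u * x) - expR (- (l + 1) * x)) * x `^ (- 1))%:E)%E.
  apply: eq_integral => x; rewrite inE/= in_itv/= andbT => x0.
  by rewrite -inner//; apply: eq_integral => u _; rewrite powR_inv1// ltW.
rewrite (tonelli_sets
   (f := fun x u => ((expR (- u * x) - expR (- (l + 1) * x)) * x `^ (- 1))%:E))//; last 2 first.
- apply/measurable_EFinP; apply: measurable_funM.
    apply: measurable_funB; first exact: measurable_expR_mul2.
    exact: (measurableT_comp (@measurable_expRM R setT (- (l + 1))) (@measurable_fst _ _ R R)).
  have mp : measurable_fun [set: R] (fun y : R => y `^ (- 1)) by exact: measurable_powR.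
  exact: (measurableT_comp mp (@measurable_fst _ _ R R)).
- move=> x u; rewrite /= !in_itv/= andbT => x0 /andP[_ ul].
  by rewrite lee_fin powR_inv1 ?ge0// ltW.
transitivity (\int[leb]_(u in `[l, (l + 1)%R]) (ln (l + 1) - ln u)%:E)%E.
  apply: eq_integral => u; rewrite inE/= in_itv/= => /andP[lu ul].
  have u0 := lt_le_trans l0 lu.
  have ul1 : 0 < u <= l + 1 by rewrite u0.
  have [_ <-] := frullani ul1.
  apply: eq_integral => x; rewrite inE/= in_itv/= andbT => x0.
  by rewrite powR_inv1// ltW.
have d u : l <= u <= l + 1 ->
    is_derive u 1 (fun u => u * ln (l + 1) - (u * ln u - u)) (ln (l + 1) - ln u).
  move=> /andP[lu _]; have u0 := lt_le_trans l0 lu; have ? := is_derive1_ln u0.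
  by apply: is_derive_eq; rewrite /GRing.scale/=; field; rewrite gt_eqF.
have c u : l <= u <= l + 1 -> {for u, continuous (fun u => ln (l + 1) - ln u)}.
  move=> /andP[lu _]; apply: cvgB; first exact: cvg_cst.
  by apply: continuous_ln; exact: lt_le_trans lu.
by rewrite (integral_FTC l1 d c); congr EFin; ring.
Qed.

End has_integral.

(** * The Gamma function *)

Section Gamma_function.
Variable R : realType.
Local Notation leb := (@lebesgue_measure R).
Implicit Types t x y : R.

Local Notation gint t := (fun x : R => x `^ (t - 1) * expR (- x)).
Local Notation Igamma t := (\int[leb]_(x in `]0%R, +oo[) (gint t x)%:E)%E.

Lemma measurable_gint (D : set R) t : measurable_fun D (gint t).
Proof.
apply: measurable_funM; last exact: measurableT_comp.
by apply: measurable_funTS; exact: measurable_powR.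
Qed.

Lemma gint_ge0 t x : 0 <= gint t x.
Proof. by rewrite mulr_ge0 ?powR_ge0 ?expR_ge0. Qed.

(** This is t times the inequality ln u <= u at u = x / (2t). The factor 2 leaves half of the decay
    of e^{-x} available. *)
Lemma powR_le_expR t x : 0 < t -> 0 < x ->
  x `^ t <= expR (t * ln (2 * t)) * expR (x / 2).
Proof.
move=> t0 x0; rewrite /powR gt_eqF// -expRD ler_expR.
have : ln (x / (2 * t)) <= x / (2 * t).
  by apply: ltW; apply: ln_sublinear; rewrite divr_gt0// mulr_gt0.
rewrite ln_div ?posrE ?mulr_gt0// lerBlDr -(ler_pM2l t0) mulrDr.
rewrite [t * (x / _)](_ : _ = x / 2); last by field; rewrite gt_eqF.
by rewrite addrC.
Qed.

Lemma is_derive_gint t x : 0 < x ->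
  is_derive x 1 (gint (t + 1)) (t * gint t x - gint (t + 1) x).
Proof.
move=> x0; have ? := is_derive1_powR (t + 1 - 1) x0.
apply: is_derive_eq; rewrite /GRing.scale/= addrK; ring.
Qed.

Lemma gint_continuous t x : 0 < x -> {for x, continuous (gint t)}.
Proof.
move=> x0; have := is_derive_gint (t - 1) x0.
by rewrite subrK => /is_derive_continuous.
Qed.

(** The shift by 2 keeps the endpoints distinct already at n = 0, as the fundamental theorem of
    calculus requires. *)
Let J n : set R := `[(n.+2%:R)^-1, n.+2%:R]%classic.

Let bigcup_itv_inv : \bigcup_n J n = `]0, +oo[%classic.
Proof.
apply/seteqP; split => x /=.
  move=> [n _] /=; rewrite /J/= !in_itv/= andbT => /andP[+ _]; apply: lt_le_trans.
  by rewrite invr_gt0.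
rewrite in_itv/= andbT => x0; exists (Num.truncn x + Num.truncn x^-1)%N => //=.
have h1 : x^-1 <= (Num.truncn x + Num.truncn x^-1).+2%:R.
  by apply: le_trans (ltW (truncnS_gt _)) _; rewrite ler_nat ltnS leqW// leq_addl.
have h2 : x <= (Num.truncn x + Num.truncn x^-1).+2%:R.
  by apply: le_trans (ltW (truncnS_gt _)) _; rewrite ler_nat ltnS leqW// leq_addr.
by rewrite /J/= in_itv/= h2 andbT -[leRHS]invrK lef_pV2 ?posrE ?invr_gt0.
Qed.

Lemma Igamma_cvg t :
  (\int[leb]_(x in J n) (gint t x)%:E @[n --> \oo] -->
   Igamma t)%E.
Proof.
rewrite -bigcup_itv_inv; apply: ge0_nondecreasing_set_cvg_integral => //.
- move=> m n mn; apply/subsetPset => x; rewrite /J/= !in_itv/= => /andP[h1 h2].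
  rewrite (le_trans h2) ?ler_nat ?ltnS//= andbT.
  by rewrite (le_trans _ h1)// lef_pV2 ?posrE// ler_nat !ltnS.
- by move=> i; exact: measurable_itv.
- by move=> i; apply/measurable_EFinP; exact: measurable_gint.
- by move=> i x _; rewrite lee_fin gint_ge0.
Qed.

(** Integration by parts on the compact intervals [J n], with boundary terms [e n] tending to 0. The
    identity lives in the extended reals, so that it can serve to prove finiteness. *)
Lemma IgammaS t : 0 < t -> Igamma (t + 1) = (t%:E * Igamma t)%E.
Proof.
move=> t0.
pose e n : R := gint (t + 1) n.+2%:R - gint (t + 1) (n.+2%:R)^-1.
have e0 : e n @[n --> \oo] --> (0 : R).
  rewrite -(subrr 0); apply: cvgB.
    apply: (@squeeze_cvgr _ _ _ _ (cst 0) (fun n => expR (t * ln (2 * t)) * 2 * n%:R^-1)).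
    - near=> n; rewrite gint_ge0/= addrK.
      have n0 : 0 < n.+2%:R :> R by [].
      have -> : expR (- n.+2%:R) = expR (- (n.+2%:R / 2)) * expR (- (n.+2%:R / 2)) :> R.
        by rewrite -expRD; congr expR; field.
      rewrite mulrA; apply: (@le_trans _ _ (expR (t * ln (2 * t)) * expR (- (n.+2%:R / 2)))).
        by rewrite ler_wpM2r ?expR_ge0// expRN ler_pdivrMr ?expR_gt0// powR_le_expR.
      rewrite -[leRHS]mulrA ler_wpM2l ?expR_ge0// expRN.
      rewrite -[leRHS]invrK lef_pV2 ?posrE ?expR_gt0 ?invr_gt0 ?mulr_gt0 ?invr_gt0//; last first.
        by rewrite ltr0n; near: n; exists 1%N.
      apply: le_trans (expR_ge1Dx _); rewrite invfM invrK -[in leRHS](addn2 n) natrD; lra.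
    - exact: cvg_cst.
    - rewrite -(mulr0 (expR (t * ln (2 * t)) * 2)); apply: cvgM; first exact: cvg_cst.
      exact: cvg_invn.
  apply: (@squeeze_cvgr _ _ _ _ (cst 0) (fun n => (n.+2%:R^-1) `^ t)).
  - near=> n; rewrite gint_ge0/= addrK; apply: ler_piMr; first exact: powR_ge0.
    by rewrite expR_le1 oppr_le0 invr_ge0.
  - exact: cvg_cst.
  - apply: ((cvg_at_rightP (fun x : R => x `^ t) 0 0).1 (powR_cvg0 t0)
      (fun n => n.+2%:R^-1)); split => [n|]; first by rewrite invr_gt0.
    by have := @cvg_invn R; rewrite -(cvg_shiftn 2); under eq_fun do rewrite addn2.
have E n : (\int[leb]_(x in J n) (gint (t + 1) x)%:E + (e n)%:E =
   t%:E * \int[leb]_(x in J n) (gint t x)%:E)%E.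
  have n12 : (n.+2%:R)^-1 < n.+2%:R :> R.
    by rewrite (@lt_trans _ _ 1)// ?invf_lt1 ?ltr1n// ltr0n.
  have pos x : (n.+2%:R)^-1 <= x <= n.+2%:R -> 0 < x.
    by move=> /andP[+ _]; apply: lt_le_trans; rewrite invr_gt0.
  have int s : leb.-integrable `[(n.+2%:R)^-1, n.+2%:R] (EFin \o gint s).
    apply: continuous_compact_integrable; first exact: segment_compact.
    apply: continuous_in_subspaceT => x; rewrite inE/= in_itv/= => /pos.
    exact: gint_continuous.
  have := @integral_FTC R (fun x => t * gint t x - gint (t + 1) x) (gint (t + 1)) _ _ n12.
  move=> /(_ (fun x h => is_derive_gint t (pos x h))).
  have cf x : 0 < x -> {for x, continuous (fun x => t * gint t x - gint (t + 1) x)}.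
    move=> x0; apply: cvgB; last exact: gint_continuous.
    by apply: cvgM; [exact: cvg_cst|exact: gint_continuous].
  move=> /(_ (fun x h => cf x (pos x h))).
  under eq_integral do rewrite EFinB.
  have it : leb.-integrable (J n) (EFin \o (fun x => t * gint t x)).
    by have := @integrableZl _ _ _ leb (J n) (measurable_itv _) t _ (int t).
  rewrite integralB_EFin// => H; rewrite -[(e n)%:E]H addeC subeK.
    under eq_integral do rewrite EFinM.
    by rewrite integralZl//; exact: int.
  by apply: integrable_fin_num => //; exact: int.
have e0' : (e n)%:E @[n --> \oo] --> (0%:E : \bar R) by apply: cvg_EFin => //; exact: nearW.
have l2 : (t%:E * \int[leb]_(x in J n) (gint t x)%:E @[n --> \oo] --> t%:E * Igamma t)%E.
  by apply: cvgeZl => //; exact: Igamma_cvg.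
have l1 : (t%:E * \int[leb]_(x in J n) (gint t x)%:E @[n --> \oo] -->
    Igamma (t + 1) + 0%:E)%E.
  under eq_fun do rewrite -E.
  by apply: cvgeD; [exact: fin_num_adde_defl|exact: Igamma_cvg|exact: e0'].
rewrite -[LHS]adde0 -[LHS](cvg_lim _ l1)//; exact: cvg_lim.
Unshelve. all: by end_near. Qed.

(** For an exponent at least 1 an exponential dominates the integrand; a smaller t is reached
    through the functional equation, since an infinite value at t would give one at t + 1. *)
Lemma Igamma_lty t : 0 < t -> (Igamma t < +oo)%E.
Proof.
have ge1 s : 1 <= s -> (Igamma s < +oo)%E.
  move=> s1; have [->|sn1] := eqVneq s 1.
    have -> : Igamma 1 = (\int[leb]_(x in `]0%R, +oo[) (expR (- 1 * x))%:E)%E.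
      by apply: eq_integral => x _; rewrite subrr powRr0 mul1r mulN1r.
    by rewrite integral_expR_itv0y ?ltry.
  have s1' : 0 < s - 1 by rewrite subr_gt0 lt_def sn1.
  set C := expR ((s - 1) * ln (2 * (s - 1))).
  apply: (@le_lt_trans _ _ (\int[leb]_(x in `]0%R, +oo[) (C%:E * (expR (- 2^-1 * x))%:E)))%E.
    apply: ge0_le_integral => //.
    - by move=> x _; rewrite lee_fin gint_ge0.
    - by apply/measurable_EFinP; exact: measurable_gint.
    - by apply: emeasurable_funM => //; apply/measurable_EFinP; exact: measurable_expRM.
    - move=> x; rewrite /= in_itv/= andbT => x0.
      rewrite -EFinM lee_fin (_ : - x = x * - 2^-1 + - 2^-1 * x); last by field.
      rewrite expRD mulrA ler_wpM2r ?expR_ge0// mulrN expRN ler_pdivrMr ?expR_gt0//.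
      exact: powR_le_expR.
  rewrite ge0_integralZl//.
  - by rewrite integral_expR_itv0y// -EFinM ltry.
  - by apply/measurable_EFinP; apply: measurableT_comp => //; exact: measurable_funM.
  - by rewrite lee_fin expR_ge0.
move=> t0; have I0 : (0 <= Igamma t)%E.
  by apply: integral_ge0 => x _; rewrite lee_fin gint_ge0.
have t1 : 1 <= t + 1 by rewrite lerDr ltW.
have := ge1 _ t1; rewrite IgammaS//; move: I0.
set I := (Igamma t); case: I => [r| |] // _; first by move=> _; rewrite ltry.
by rewrite gt0_muley// lte_fin.
Qed.

Lemma GammaE t : 0 < t -> Igamma t = (Gamma t)%:E.
Proof.
move=> t0; rewrite /Gamma /Rintegral fineK// ge0_fin_numE ?Igamma_lty//.
by apply: integral_ge0 => x _; rewrite lee_fin gint_ge0.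
Qed.

Lemma integrable_gint t : 0 < t -> leb.-integrable `]0%R, +oo[ (EFin \o gint t).
Proof.
move=> t0; apply/integrableP; split.
  by apply/measurable_EFinP; exact: measurable_gint.
under eq_integral do rewrite /= ger0_norm ?gint_ge0//.
exact: Igamma_lty.
Qed.

Lemma GammaS t : 0 < t -> Gamma (t + 1) = t * Gamma t.
Proof.
by move=> t0; apply: EFin_inj; rewrite EFinM -!GammaE ?addr_gt0//; exact: IgammaS.
Qed.

Lemma Gamma_gt0 t : 0 < t -> 0 < Gamma t.
Proof.
have ge1 (s : R) : 1 <= s -> 0 < Gamma s.
  move=> s1; have s0 : 0 < s by rewrite (lt_le_trans _ s1).
  rewrite -lte_fin -(GammaE s0).
  apply: (@lt_le_trans _ _ (\int[leb]_(x in `[1%R, 2%R]) (expR (- 2))%:E)%E).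
    rewrite integral_cst//= lebesgue_measure_itv/= lte_fin ltr1n/= -EFinB -EFinM lte_fin.
    by rewrite mulr_gt0 ?expR_gt0// subr_gt0 ltr1n.
  apply: (@le_trans _ _ (\int[leb]_(x in `[1%R, 2%R]) (gint s x)%:E)%E).
    apply: ge0_le_integral => //.
    - by apply/measurable_EFinP; exact: measurable_gint.
    - move=> x; rewrite /= in_itv/= => /andP[x1 x2]; rewrite lee_fin.
      rewrite -[leLHS]mul1r ler_pM ?expR_ge0// ?ler_expR ?lerN2//.
      by rewrite -[leLHS](powRr0 x) ler_powR// subr_ge0.
  apply: ge0_subset_integral => //.
  - by apply/measurable_EFinP; exact: measurable_gint.
  - by move=> x _; rewrite lee_fin gint_ge0.
  - move=> x; rewrite /= !in_itv/= andbT => /andP[x1 _]; exact: lt_le_trans x1.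
move=> t0; have t1 : 1 <= t + 1 by rewrite lerDr ltW.
by have := ge1 _ t1; rewrite GammaS// pmulr_rgt0.
Qed.

End Gamma_function.

(* Locked, because conversion tests on [Gamma] unfold the integral. *)
HB.lock Definition lngamma {R : realType} (t : R) : R := ln (Gamma t).

(** * Log-convexity of Gamma and the resulting slope bounds *)

Section ln_Gamma.
Variable R : realType.
Implicit Types t x y h s r d l : R.

Lemma expR_convex (w p q : R) : 0 <= w <= 1 ->
  expR ((1 - w) * p + w * q) <= (1 - w) * expR p + w * expR q.
Proof.
move=> /andP[w0 w1]; set c := (1 - w) * p + w * q.
have tangent r : expR c * (1 + (r - c)) <= expR r.
  have -> : expR r = expR c * expR (r - c) by rewrite -expRD addrC subrK.
  by rewrite ler_wpM2l ?expR_ge0 ?expR_ge1Dx.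
have w1' : 0 <= 1 - w by rewrite subr_ge0.
apply: le_trans (_ : (1 - w) * (expR c * (1 + (p - c))) +
                     w * (expR c * (1 + (q - c))) <= _).
  by rewrite le_eqVlt; apply/orP; left; apply/eqP; rewrite [in RHS]/c; ring.
by rewrite lerD// ler_wpM2l.
Qed.

Lemma GammaE_expR s : 0 < s -> Gamma s = expR (lngamma s).
Proof. by move=> s0; rewrite unlock lnK// posrE Gamma_gt0. Qed.

Lemma has_integral_Gamma t : 0 < t ->
  has_integral (fun x => x `^ (t - 1) * expR (- x)) (Gamma t).
Proof. by move=> t0; split; [exact: integrable_gint|exact: GammaE]. Qed.

(* Hoelder's inequality, by weighted AM-GM on the normalised integrands. *)
Lemma lngamma_convex (w : R) x y : 0 <= w <= 1 -> 0 < x -> 0 < y ->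
  lngamma ((1 - w) * x + w * y) <= (1 - w) * lngamma x + w * lngamma y.
Proof.
move=> w01 x0 y0; have /andP[w0 w1] := w01.
have w1' : 0 <= 1 - w by rewrite subr_ge0.
set z := (1 - w) * x + w * y.
have z0 : 0 < z.
  rewrite /z; have [->|wn0] := eqVneq w 0; first by rewrite subr0 mul1r mul0r addr0.
  by rewrite ltr_wpDl ?mulr_ge0 ?(ltW x0)// mulr_gt0// lt_def wn0.
set a := lngamma x; set b := lngamma y; set m := _ + _.
have eG := GammaE_expR.
have eGN s : 0 < s -> expR (- lngamma s) * Gamma s = 1.
  by move=> s0; rewrite eG// -expRD addNr expR0.
suff : Gamma z * expR (- m) <= 1.
  by rewrite expRN ler_pdivrMr ?expR_gt0// mul1r eG// ler_expR.
have -> : 1 = (1 - w) * expR (- a) * Gamma x + w * expR (- b) * Gamma y.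
  by rewrite -!mulrA eGN// eGN// !mulr1 subrK.
rewrite mulrC.
apply: has_integral_le (has_integralZ _ (has_integral_Gamma z0))
  (has_integralD (has_integralZ _ (has_integral_Gamma x0))
                 (has_integralZ _ (has_integral_Gamma y0))) => s s0.
have gE r : s `^ (r - 1) * expR (- s) = expR ((r - 1) * ln s - s).
  by rewrite /powR gt_eqF// -expRD.
rewrite !gE -!expRD -!mulrA -!expRD.
apply: le_trans (expR_convex _ _ w01); rewrite ler_expR le_eqVlt.
by apply/orP; left; apply/eqP; rewrite /z /m; ring.
Qed.

Lemma lngammaS x : 0 < x -> lngamma (x + 1) = ln x + lngamma x.
Proof. by move=> x0; rewrite !unlock GammaS// lnM ?posrE// Gamma_gt0. Qed.

(** By the functional equation the chord over [x, x + 1] has slope ln x, and convexity puts the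
    graph below it. *)
Lemma lngamma_slope_le x h : 0 < x -> 0 <= h <= 1 ->
  lngamma (x + h) - lngamma x <= h * ln x.
Proof.
move=> x0 h01; have := lngamma_convex h01 x0 (addr_gt0 x0 ltr01).
rewrite (_ : _ * x + _ = x + h); last by ring.
rewrite lngammaS//; lra.
Qed.

(** The point x is a barycentre of x - d and x + h, so convexity orders the slopes on its two
    sides. *)
Lemma lngamma_slope_ge x d h : 0 < d < x -> 0 <= h ->
  h * (lngamma x - lngamma (x - d)) <= d * (lngamma (x + h) - lngamma x).
Proof.
move=> /andP[d0 dx] h0; have dh0 : 0 < d + h by rewrite ltr_wpDr.
have w01 : 0 <= h / (d + h) <= 1.
  by rewrite divr_ge0 ?(ltW dh0)//= ler_pdivrMr// mul1r lerDr ltW.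
have xh0 : 0 < x + h by rewrite ltr_wpDr// (lt_trans d0).
have xd0 : 0 < x - d by rewrite subr_gt0.
have := lngamma_convex w01 xh0 xd0.
have -> : (1 - h / (d + h)) * (x + h) + h / (d + h) * (x - d) = x.
  by field; rewrite gt_eqF.
rewrite -(ler_pM2l dh0) [leRHS](_ : _ = d * lngamma (x + h) + h * lngamma (x - d)).
  lra.
by field; rewrite gt_eqF.
Qed.

Lemma lngamma_slope_geS x h : 1 < x -> 0 <= h ->
  h * ln (x - 1) <= lngamma (x + h) - lngamma x.
Proof.
move=> x1 h0; have := @lngamma_slope_ge x 1 h; rewrite ltr01/= mul1r => /(_ x1 h0).
have := @lngammaS (x - 1); rewrite subrK subr_gt0 => /(_ x1) ->.
by rewrite addrK.
Qed.

(** Iteration gives phi(b^n) <= phi(1) + n ln b, which tends to minus infinity. *)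
Lemma unbounded_below_contraction (phi : R -> R) (b K : R) : 0 < b < 1 ->
  (forall l, 0 < l <= 1 -> phi (b * l) <= phi l + ln b) ->
  (forall l, 0 < l <= 1 -> K <= phi l) -> False.
Proof.
move=> /andP[b0 b1] phib phiK.
have lnb : ln b < 0 by rewrite ln_lt0// b0.
have bn n : 0 < b ^+ n <= 1 by rewrite exprn_gt0//= exprn_ile1 ?ltW.
have H n : phi (b ^+ n) <= phi 1 + n%:R * ln b.
  elim: n => [|n IH]; first by rewrite expr0 mul0r addr0.
  rewrite exprS (le_trans (phib _ (bn n)))// -natr1 mulrDl mul1r addrA lerD2r.
  exact: IH.
pose n := (Num.truncn ((phi 1 - K) / - ln b)).+1.
have := le_trans (phiK _ (bn n)) (H n).
have : (phi 1 - K) / - ln b < n%:R by exact: truncnS_gt.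
rewrite ltr_pdivrMr ?oppr_gt0//; lra.
Qed.

End ln_Gamma.

(** * The Bernoulli generating function *)

Section exponential_bounds.
Variable R : realType.
Implicit Types x y : R.

(** In this bound and the next two, the difference of the sides vanishes at 0 and has the preceding
    bound as its derivative; the chain starts from e^{-x} >= 1 - x. *)
Lemma expRN_taylor2_le y : 0 <= y -> expR (- y) <= 1 - y + y ^+ 2 / 2.
Proof.
move=> y0; rewrite -subr_ge0.
pose F x : R := 1 - x + x ^+ 2 / 2 - expR (- x).
have := @le_of_derive R F (fun x => expR (- x) - (1 - x)) 0 y y0.
rewrite (_ : F 0 = 0); last by rewrite /F oppr0 expR0; lra.
apply.
- by move=> x _; rewrite /F; apply: is_derive_eq; rewrite /GRing.scale/=; lra.
- by move=> x _; rewrite subr_ge0 expR_ge1Dx.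
Qed.

Lemma expRN_taylor3_ge y : 0 <= y -> 1 - y + y ^+ 2 / 2 - y ^+ 3 / 6 <= expR (- y).
Proof.
move=> y0; rewrite -subr_ge0.
pose F x : R := expR (- x) - (1 - x + x ^+ 2 / 2 - x ^+ 3 / 6).
have := @le_of_derive R F (fun x => 1 - x + x ^+ 2 / 2 - expR (- x)) 0 y y0.
rewrite (_ : F 0 = 0); last by rewrite /F oppr0 expR0; lra.
apply.
- by move=> x _; rewrite /F; apply: is_derive_eq; rewrite /GRing.scale/=; lra.
- by move=> x /andP[x0 _]; rewrite subr_ge0 expRN_taylor2_le.
Qed.

Lemma expRN_taylor4_le y : 0 <= y ->
  expR (- y) <= 1 - y + y ^+ 2 / 2 - y ^+ 3 / 6 + y ^+ 4 / 24.
Proof.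
move=> y0; rewrite -subr_ge0.
pose F x : R := 1 - x + x ^+ 2 / 2 - x ^+ 3 / 6 + x ^+ 4 / 24 - expR (- x).
have := @le_of_derive R F (fun x => expR (- x) - (1 - x + x ^+ 2 / 2 - x ^+ 3 / 6)) 0 y y0.
rewrite (_ : F 0 = 0); last by rewrite /F oppr0 expR0; lra.
apply.
- by move=> x _; rewrite /F; apply: is_derive_eq; rewrite /GRing.scale/=; lra.
- by move=> x /andP[x0 _]; rewrite subr_ge0 expRN_taylor3_ge.
Qed.

(** This is tanh(x/2) <= x/2, written in e^{-x}. *)
Lemma expRN_double_ge x : 0 <= x -> 2 * (1 - expR (- x)) <= x * (1 + expR (- x)).
Proof.
move=> x0; rewrite -subr_ge0.
pose F x : R := x * (1 + expR (- x)) - 2 * (1 - expR (- x)).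
have := @le_of_derive R F (fun x => 1 - (1 + x) * expR (- x)) 0 x x0.
rewrite (_ : F 0 = 0); last by rewrite /F oppr0 expR0; lra.
apply.
- by move=> y _; rewrite /F; apply: is_derive_eq; rewrite /GRing.scale/=; lra.
- move=> y /andP[y0 _]; rewrite subr_ge0 expRN ler_pdivrMr ?expR_gt0// mul1r.
  exact: expR_ge1Dx.
Qed.

(* Multiplied by [expR x], the difference of the two sides is
   4 \sum_(n >= 2) (n - 1) x^(2n+1) / (2n+1)!. *)
Lemma expRN_cubic_ge x : 0 <= x ->
  3 * (1 - expR (- x) ^+ 2) <= x * (1 + 4 * expR (- x) + expR (- x) ^+ 2).
Proof.
move=> x0; have ge0_of (F G : R -> R) : F 0 = 0 ->
    (forall x, is_derive x 1 F (G x)) -> (forall x, 0 <= x -> 0 <= G x) ->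
    forall x, 0 <= x -> 0 <= F x.
  move=> F0 FG G0 y y0; rewrite -F0; apply: (@le_of_derive _ _ G) => // z /andP[z0 _].
  exact: G0.
(* The target, multiplied by e^x, is [e5]. Three differentiations lead from it to [e2], through
   functions that vanish at 0. *)
have e2 : forall y, 0 <= y -> 0 <= y * (expR y - expR (- y)) :> R.
  move=> y y0; rewrite mulr_ge0// subr_ge0 ler_expR; lra.
have e3 : forall y, 0 <= y -> 0 <= y * (expR y + expR (- y)) - (expR y - expR (- y)) :> R.
  apply: ge0_of e2; first by rewrite oppr0 expR0; lra.
  by move=> y; apply: is_derive_eq; rewrite /GRing.scale/=; lra.
have e4 : forall y, 0 <= y ->
    0 <= 4 - 2 * (expR y + expR (- y)) + y * (expR y - expR (- y)) :> R.
  apply: ge0_of e3; first by rewrite oppr0 expR0; lra.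
  by move=> y; apply: is_derive_eq; rewrite /GRing.scale/=; lra.
have e5 : forall y, 0 <= y ->
    0 <= y * (expR y + 4 + expR (- y)) - 3 * (expR y - expR (- y)) :> R.
  apply: ge0_of e4; first by rewrite oppr0 expR0; lra.
  by move=> y; apply: is_derive_eq; rewrite /GRing.scale/=; lra.
have := e5 _ x0; rewrite -(pmulr_rge0 _ (expR_gt0 (- x))).
have := expRxMexpNx_1 x; set u := expR x; set v := expR (- x) => uv.
have -> : v * (x * (u + 4 + v) - 3 * (u - v)) =
  x * ((u * v) + 4 * v + v ^+ 2) - 3 * (u * v - v ^+ 2) by ring.
by rewrite uv subr_ge0.
Qed.

End exponential_bounds.

Section bernoulli_generating_function.
Variable R : realType.
Implicit Types (t x : R).

(* \sum_n B_n(t) (-x)^n / n!, with B_n the Bernoulli polynomials. *)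
Definition bgf t x : R := x * expR (- t * x) / (1 - expR (- x)).

Definition bernoulli2 t : R := t ^+ 2 - t + 6^-1.

Definition dbgf t x : R := expR (- t * x) *
  ((1 - t * x) * (1 - expR (- x)) - x * expR (- x)) / (1 - expR (- x)) ^+ 2.

Definition d2bgf t x : R := expR (- t * x) *
  (x * ((t * (1 - expR (- x)) + expR (- x)) ^+ 2 + expR (- x))
   - 2 * (1 - expR (- x)) * (t * (1 - expR (- x)) + expR (- x)))
  / (1 - expR (- x)) ^+ 3.

Lemma onem_expRN_gt0 x : 0 < x -> 0 < 1 - expR (- x).
Proof. by move=> x0; rewrite subr_gt0 expR_lt1 oppr_lt0. Qed.

Lemma is_derive_bgf t x : 0 < x -> is_derive x 1 (bgf t) (dbgf t x).
Proof.
move=> x0; have D0 := onem_expRN_gt0 x0.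
have ? : is_derive x 1 (fun y => (1 - expR (- y))^-1 : R)
    (- (1 - expR (- x)) ^- 2 *: expR (- x)).
  apply: is_deriveV; first by rewrite gt_eqF.
  by apply: is_derive_eq; rewrite /GRing.scale/=; lra.
rewrite /bgf; apply: is_derive_eq; rewrite /GRing.scale/= /dbgf.
by field; rewrite gt_eqF.
Qed.

Lemma is_derive_dbgf t x : 0 < x -> is_derive x 1 (dbgf t) (d2bgf t x).
Proof.
move=> x0; have D0 := onem_expRN_gt0 x0.
have ? : is_derive x 1 (fun y => ((1 - expR (- y)) ^+ 2)^-1 : R)
    (- ((1 - expR (- x)) ^+ 2) ^- 2 *: (2 * (1 - expR (- x)) * expR (- x))).
  apply: is_deriveV; first by rewrite sqrf_eq0 gt_eqF.
  by apply: is_derive_eq; rewrite /GRing.scale/=; ring.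
rewrite /dbgf; apply: is_derive_eq; rewrite /GRing.scale/= /d2bgf.
by field; rewrite gt_eqF.
Qed.

Lemma bgf_continuous t x : 0 < x -> {for x, continuous (bgf t)}.
Proof. by move=> /(is_derive_bgf t)/is_derive_continuous. Qed.

Lemma bgf_gt0 t x : 0 < x -> 0 < bgf t x.
Proof. by move=> x0; rewrite divr_gt0 ?onem_expRN_gt0// mulr_gt0// expR_gt0. Qed.

Lemma bgf_le t x : 0 <= t -> 0 < x -> bgf t x <= 1 + x.
Proof.
move=> t0 x0; rewrite ler_pdivrMr ?onem_expRN_gt0//.
have e1 : expR (- t * x) <= 1 by rewrite expR_le1 mulNr oppr_le0 mulr_ge0// ltW.
have : (1 + x) * expR (- x) <= 1.
  by rewrite expRN ler_pdivrMr ?expR_gt0// mul1r expR_ge1Dx.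
nra.
Qed.

(** A crude constant, large enough both for x >= 1, where each term is compared with x^3 separately,
    and for x < 1, where Taylor's formula is used. *)
Definition bgf_taylor_bound t : R :=
  3 + t ^+ 3 + 2 * `|t - 2^-1| + 3 * `|bernoulli2 t / 2|.

(** For x >= 1 every term is at most a multiple of x^3. For x < 1 the fraction is cleared and the
    exponentials are replaced by Taylor polynomials with controlled remainders. *)
Lemma bgf_taylor t x : 0 <= t -> 0 < x ->
  `|bgf t x - (1 - (t - 2^-1) * x + bernoulli2 t / 2 * x ^+ 2)| <=
    bgf_taylor_bound t * x ^+ 3.
Proof.
move=> t0 x0; set s := t - 2^-1; set b := bernoulli2 t / 2.
have t3 : 0 <= t ^+ 3 by exact: exprn_ge0.
have [x1|x1] := leP 1 x.
  apply: (@le_trans _ _ ((1 + x) + (1 + `|s| * x + `|b| * x ^+ 2))).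
    rewrite (le_trans (ler_normB _ _))// (gtr0_norm (bgf_gt0 t x0)).
    rewrite lerD ?bgf_le// (le_trans (ler_normD _ _))// lerD//.
      by rewrite (le_trans (ler_normB _ _))// normr1 normrM (gtr0_norm x0).
    by rewrite normrM normrX (gtr0_norm x0).
  have x12 : 1 <= x ^+ 2 by rewrite exprn_ege1.
  have x23 : x ^+ 2 <= x ^+ 3 by rewrite ler_weXn2l.
  have xx3 : x <= x ^+ 3 by rewrite -[leLHS]expr1 ler_weXn2l.
  have x13 : 1 <= x ^+ 3 by rewrite exprn_ege1.
  have := normr_ge0 s; have := normr_ge0 b.
  rewrite /bgf_taylor_bound -/s -/b; nra.
have D0 := onem_expRN_gt0 x0.
set E := expR (- x) in D0 *.
have r1l : 1 - x + x ^+ 2 / 2 - x ^+ 3 / 6 <= E by exact: expRN_taylor3_ge (ltW x0).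
have r1u : E <= 1 - x + x ^+ 2 / 2 - x ^+ 3 / 6 + x ^+ 4 / 24.
  exact: expRN_taylor4_le (ltW x0).
have tx0 : 0 <= t * x by rewrite mulr_ge0// ltW.
have r2l := expRN_taylor3_ge tx0; have r2u := expRN_taylor2_le tx0.
rewrite -mulNr in r2l r2u; set e := expR (- t * x) in r2l r2u.
(* The denominator costs one power of x, so the numerator has to be bounded by a multiple of x^4. *)
have DE : x / 2 <= 1 - E by have := @expRN_taylor2_le _ x (ltW x0); rewrite -/E; nra.
have -> : bgf t x - (1 - s * x + b * x ^+ 2) =
    (x * e - (1 - s * x + b * x ^+ 2) * (1 - E)) / (1 - E).
  by rewrite /bgf -/E -/e; field; rewrite gt_eqF.
rewrite normrM normfV (gtr0_norm D0) ler_pdivrMr//.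
pose r1 := E - (1 - x + x ^+ 2 / 2 - x ^+ 3 / 6).
pose r2 := 1 - t * x + (t * x) ^+ 2 / 2 - e.
(* The coefficients 1, 1/2 - t and B_2(t)/2 are exactly those that cancel the numerator up to order
   x^3. *)
have -> : x * e - (1 - s * x + b * x ^+ 2) * (1 - E) =
   - (x * r2) + ((s / 6 + b / 2) * x ^+ 4 - b / 6 * x ^+ 5) + (1 - s * x + b * x ^+ 2) * r1.
  by rewrite /r1 /r2 /s /b /bernoulli2; field.
have x40 : 0 <= x ^+ 4 by rewrite exprn_ge0// ltW.
have x54 : x ^+ 5 <= x ^+ 4 by rewrite ler_wiXn2l// ltW.
have x50 : 0 <= x ^+ 5 by rewrite exprn_ge0// ltW.
have r1b : `|r1| <= x ^+ 4 / 24 by rewrite ger0_norm /r1; lra.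
have r2b : `|r2| <= t ^+ 3 * x ^+ 3 / 6 by rewrite -exprMn ger0_norm /r2; lra.
apply: (@le_trans _ _ (x * (t ^+ 3 * x ^+ 3 / 6) +
    ((`|s| / 6 + `|b| / 2) * x ^+ 4 + `|b| / 6 * x ^+ 4) +
    (1 + `|s| + `|b|) * (x ^+ 4 / 24))).
  rewrite (le_trans (ler_normD _ _))// lerD//.
    rewrite (le_trans (ler_normD _ _))// lerD//.
      by rewrite normrN normrM (gtr0_norm x0) ler_wpM2l// ltW.
    rewrite (le_trans (ler_normB _ _))// lerD//.
      rewrite normrM (ger0_norm x40) ler_wpM2r// (le_trans (ler_normD _ _))//.
      by rewrite (normrM s) (normrM b) (ger0_norm (_ : 0 <= 6^-1))// (ger0_norm (_ : 0 <= 2^-1)).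
    rewrite (normrM (b / 6)) (normrM b) (ger0_norm x50) (ger0_norm (_ : 0 <= 6^-1))//.
    by rewrite ler_wpM2l// mulr_ge0.
  rewrite normrM ler_pM// (le_trans (ler_normD _ _))// lerD//.
    rewrite (le_trans (ler_normB _ _))// normr1 lerD// normrM (gtr0_norm x0).
    by rewrite ler_piMr// ltW.
  by rewrite normrM normrX (gtr0_norm x0) ler_piMr// exprn_ile1// ltW.
apply: (@le_trans _ _ (bgf_taylor_bound t * x ^+ 3 * (x / 2))); last first.
  rewrite ler_wpM2l// mulr_ge0 ?exprn_ge0 ?(ltW x0)// /bgf_taylor_bound.
  by rewrite !addr_ge0// mulr_ge0.
have -> : bgf_taylor_bound t * x ^+ 3 * (x / 2) = bgf_taylor_bound t / 2 * x ^+ 4 by ring.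
have -> : x * (t ^+ 3 * x ^+ 3 / 6) = t ^+ 3 / 6 * x ^+ 4 by ring.
rewrite [X in _ + X](_ : _ = (1 + `|s| + `|b|) / 24 * x ^+ 4); last by ring.
rewrite -!mulrDl ler_wpM2r// /bgf_taylor_bound -/s -/b.
have := normr_ge0 s; have := normr_ge0 b; lra.
Qed.

(** At t = 1/2 the function is (x/2) / sinh(x/2), and its derivative is nonpositive by tanh(x/2) <=
    x/2. *)
Lemma bgf_half_nincr x y : 0 < x -> x <= y -> bgf 2^-1 y <= bgf 2^-1 x.
Proof.
move=> x0 xy; rewrite -lerN2.
apply: (@le_of_derive R (fun z => - bgf 2^-1 z) (fun z => - dbgf 2^-1 z) x y xy) => z /andP[xz _].
  by have ? := is_derive_bgf 2^-1 (lt_le_trans x0 xz); exact: is_deriveN.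
have z0 := lt_le_trans x0 xz.
rewrite oppr_ge0 /dbgf mulr_le0_ge0//; last by rewrite invr_ge0 exprn_ge0// ltW// onem_expRN_gt0.
rewrite mulr_ge0_le0// ?expR_ge0//.
have := expRN_double_ge (ltW z0); lra.
Qed.

(** With s = t - 1/2 one has B_2(t) = s^2 - 1/12. Expanding the numerator of the second derivative
    in s splits it into three nonnegative terms: a multiple of s^2 - 1/12, s times the tanh
    inequality, and the cubic inequality [expRN_cubic_ge]. *)
Lemma d2bgf_ge0 t x : t0 R <= t -> 0 < x -> 0 <= d2bgf t x.
Proof.
move=> tt0 x0; have D0 := onem_expRN_gt0 x0.
rewrite /d2bgf divr_ge0//; last by rewrite exprn_ge0// ltW.
rewrite mulr_ge0 ?expR_ge0//.
have s3 : 0 < Num.sqrt 3 :> R by rewrite sqrtr_gt0.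
have s32 : Num.sqrt 3 ^+ 2 = 3 :> R by rewrite sqr_sqrtr.
have : (2 * Num.sqrt 3)^-1 <= t - 2^-1 by move: tt0; rewrite /t0; lra.
set s := t - 2^-1 => st0.
have s0 : 0 <= s by apply: le_trans st0; rewrite invr_ge0 mulr_ge0// ltW.
have s12 : 12^-1 <= s ^+ 2.
  have -> : 12^-1 = (2 * Num.sqrt 3)^-1 ^+ 2 :> R.
    by rewrite exprVn exprMn s32; congr _^-1; ring.
  by rewrite lerXn2r ?nnegrE// invr_ge0 mulr_ge0// ltW.
have hA := expRN_cubic_ge (ltW x0); have hB := expRN_double_ge (ltW x0).
have E0 := expR_gt0 (- x); set E := expR (- x) in D0 hA hB E0 *.
have -> : t = s + 2^-1 by rewrite /s; ring.
have -> : x * (((s + 2^-1) * (1 - E) + E) ^+ 2 + E) -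
    2 * (1 - E) * ((s + 2^-1) * (1 - E) + E) =
  (s ^+ 2 - 12^-1) * (x * (1 - E) ^+ 2) +
  s * (1 - E) * (x * (1 + E) - 2 * (1 - E)) +
  (x * (1 + 4 * E + E ^+ 2) - 3 * (1 - E ^+ 2)) / 3 by field.
rewrite !addr_ge0//.
- by rewrite mulr_ge0 ?subr_ge0// mulr_ge0 ?exprn_ge0// ltW.
- by rewrite mulr_ge0 ?subr_ge0// mulr_ge0// ltW.
- by rewrite divr_ge0// subr_ge0.
Qed.

Lemma dbgf_ndecr t x y : t0 R <= t -> 0 < x -> x <= y -> dbgf t x <= dbgf t y.
Proof.
move=> tt0 x0 xy; apply: (@le_of_derive R (dbgf t) (d2bgf t) x y xy) => z /andP[xz _].
  exact: (is_derive_dbgf t (lt_le_trans x0 xz)).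
exact: (d2bgf_ge0 tt0 (lt_le_trans x0 xz)).
Qed.

(* Convexity of [bgf t]: its slope over [[ax, bx]] is at most its slope over
   the dilated interval [[ax/c, bx/c]]. *)
Lemma bgf_dilation t a b c x : t0 R <= t -> 0 < a -> a <= b -> 0 < c <= 1 -> 0 < x ->
  c * (bgf t (a * (x / c)) - bgf t (b * (x / c))) <= bgf t (a * x) - bgf t (b * x).
Proof.
move=> tt0 a0 ab /andP[c0 c1] x0.
pose J y := c * bgf t (y * (x / c)) - bgf t (y * x).
pose J' y := x * dbgf t (y * (x / c)) - x * dbgf t (y * x).
suff : J a <= J b by rewrite /J; lra.
apply: (@le_of_derive R J J' a b ab) => z /andP[az _]; have z0 := lt_le_trans a0 az.
  have d1 : is_derive z 1 (bgf t \o (fun y => y * (x / c))) (dbgf t (z * (x / c)) * (x / c)).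
    apply: is_derive1_comp; first by apply: is_derive_bgf; rewrite mulr_gt0// divr_gt0.
    by apply: is_derive_eq; rewrite /GRing.scale/=; ring.
  have d2 : is_derive z 1 (bgf t \o (fun y => y * x)) (dbgf t (z * x) * x).
    apply: is_derive1_comp; first by apply: is_derive_bgf; rewrite mulr_gt0.
    by apply: is_derive_eq; rewrite /GRing.scale/=; ring.
  rewrite (_ : J = c \*: (bgf t \o (fun y => y * (x / c))) - (bgf t \o (fun y => y * x)))//.
  apply: is_derive_eq; rewrite /J' /GRing.scale/=; field; by rewrite gt_eqF.
rewrite (_ : J' z = x * (dbgf t (z * (x / c)) - dbgf t (z * x))); last by rewrite /J'; ring.
rewrite mulr_ge0 ?(ltW x0)// subr_ge0; apply: dbgf_ndecr => //.
  by rewrite mulr_gt0.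
by rewrite ler_pM2l// ler_pdivlMr// ler_piMr// ltW.
Qed.

(** This bounds the Levy density from below by that of a gamma law. It uses [bgf t x] = e^{-sx}
    phi(x) with s = t - 1/2 and phi nonincreasing: phi(bx) is replaced by phi(ax) >= e^{-ax/2}, and
    e^{-sax} - e^{-sbx} is at least s (b - a) x e^{-sbx}. *)
Lemma bgf_diff_ge t a b x : 2^-1 <= t -> 0 < a -> a <= b -> 0 < x ->
  (t - 2^-1) * (b - a) * x * expR (- ((t - 2^-1) * b + a / 2) * x) <=
    bgf t (a * x) - bgf t (b * x).
Proof.
move=> th a0 ab x0; set s := t - 2^-1; have s0 : 0 <= s by rewrite subr_ge0.
have ax0 : 0 < a * x by rewrite mulr_gt0.
have axbx : a * x <= b * x by rewrite ler_pM2r.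
have bx0 := lt_le_trans ax0 axbx.
have pE y : bgf t y = expR (- s * y) * bgf 2^-1 y.
  rewrite /bgf mulrA mulrCA -expRD; congr (_ * expR _ / _); rewrite /s; ring.
have phi_ge : expR (- (a / 2) * x) <= bgf 2^-1 (a * x).
  rewrite /bgf ler_pdivlMr ?onem_expRN_gt0// mulrC.
  rewrite [X in _ <= _ * X](_ : _ = expR (- (a / 2) * x)); last by congr expR; ring.
  rewrite ler_wpM2r ?expR_ge0//; have := expR_ge1Dx (- (a * x)); lra.
apply: (@le_trans _ _ (bgf 2^-1 (a * x) * (expR (- s * (a * x)) - expR (- s * (b * x))))).
  apply: (@le_trans _ _ (expR (- (a / 2) * x) * (expR (- s * (b * x)) * (s * (b - a) * x)))).
    rewrite [leRHS]mulrA -expRD mulrC le_eqVlt; apply/orP; left; apply/eqP.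
    by congr (expR _ * _); ring.
  rewrite ler_pM ?expR_ge0//.
    by rewrite mulr_ge0 ?expR_ge0// !mulr_ge0 ?subr_ge0// ltW.
  have -> : expR (- s * (a * x)) = expR (- s * (b * x)) * expR (s * (b - a) * x).
    by rewrite -expRD; congr expR; ring.
  set A := expR (- s * (b * x)).
  rewrite (_ : A * _ - A = A * (expR (s * (b - a) * x) - 1)); last by ring.
  rewrite ler_wpM2l ?expR_ge0//.
  have := expR_ge1Dx (s * (b - a) * x); lra.
rewrite !pE; have := bgf_half_nincr ax0 axbx; have := expR_ge0 (- s * (b * x)); nra.
Qed.

End bernoulli_generating_function.

(** * Binet's formula *)

Section binet.
Variable R : realType.
Local Notation leb := (@lebesgue_measure R).
Local Notation Rp := (`]0, +oo[%classic : set R).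
Implicit Types (t x y l h : R) (g : R -> R).

Lemma measurable_of_continuous_pos g :
  (forall x, 0 < x -> {for x, continuous g}) -> measurable_fun Rp g.
Proof.
move=> cg; apply: open_continuous_measurable_fun; first exact: interval_open.
by move=> x; rewrite inE/= in_itv/= andbT; exact: cg.
Qed.

Lemma x_expR_le l x : 0 < l -> 0 < x -> x * expR (- l * x) <= 2 / l * expR (- (l / 2) * x).
Proof.
move=> l0 x0; have -> : - l * x = - (l / 2) * x + - (l / 2) * x by field.
rewrite expRD mulrA ler_wpM2r ?expR_ge0// mulNr expRN ler_pdivrMr ?expR_gt0//.
have := expR_ge1Dx (l / 2 * x) => H.
rewrite [leLHS](_ : x = 2 / l * (l / 2 * x)); last by field; rewrite gt_eqF.
rewrite ler_wpM2l ?divr_ge0 ?(ltW l0)//; lra.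
Qed.

Definition laplace_int g l : R := \int[leb]_(x in Rp) (expR (- l * x) * g x).

(** Watson's lemma to first order with an explicit error. The factor 4 comes from x e^{-lx} <= (2/l)
    e^{-lx/2}, integrated over the half-line. *)
Lemma watson g (g0 C : R) : measurable_fun Rp g ->
  (forall x, 0 < x -> `|g x - g0| <= C * x) ->
  forall l, 0 < l -> has_integral (fun x => expR (- l * x) * g x) (laplace_int g l) /\
    `|laplace_int g l - g0 / l| <= 4 * C / l ^+ 2.
Proof.
move=> mg gC l l0; have l20 : 0 < l / 2 by rewrite divr_gt0.
have C0 : 0 <= C by have := gC 1 ltr01; rewrite mulr1; exact: le_trans.
have i0 := has_integralZ g0 (has_integral_expR l0).
have i1 := has_integralZ (C * (2 / l)) (has_integral_expR l20).
have bnd x : 0 < x -> `|expR (- l * x) * (g x - g0)| <= C * (2 / l) * expR (- (l / 2) * x).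
  move=> x0; rewrite normrM (ger0_norm (expR_ge0 _)).
  apply: (@le_trans _ _ (C * (x * expR (- l * x)))).
    by rewrite mulrA [leLHS]mulrC ler_wpM2r ?expR_ge0 ?gC.
  by rewrite -[leRHS]mulrA ler_wpM2l// x_expR_le.
have md : measurable_fun Rp (fun x => expR (- l * x) * (g x - g0)).
  by apply: measurable_funM; [exact: measurable_expRM|exact: measurable_funB].
have i2 := has_integral_dominated md bnd i1.
have i3 : has_integral (fun x => expR (- l * x) * g x)
    (\int[leb]_(x in Rp) (expR (- l * x) * (g x - g0)) + g0 * l^-1).
  by apply: has_integral_ext (has_integralD i2 i0) => x _; ring.
have iE : laplace_int g l = \int[leb]_(x in Rp) (expR (- l * x) * (g x - g0)) + g0 * l^-1.
  by case: i3 => _ i3; rewrite /laplace_int /Rintegral i3.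
split; first by rewrite iE.
have -> : laplace_int g l - g0 / l = \int[leb]_(x in Rp) (expR (- l * x) * (g x - g0)).
  by rewrite iE addrK.
rewrite (_ : 4 * C / l ^+ 2 = C * (2 / l) * (l / 2)^-1); last by field; rewrite gt_eqF.
rewrite ler_norml; apply/andP; split.
  have i1N := has_integralZ (- 1) i1; rewrite -mulN1r.
  by apply: has_integral_le i1N i2 => x /bnd; rewrite ler_norml mulN1r => /andP[].
by apply: has_integral_le i2 i1 => x /bnd; rewrite ler_norml => /andP[].
Qed.

Definition bgf_rem t x : R := (bgf t x - 1 + (t - 2^-1) * x) / x ^+ 2.

Lemma bgf_rem_near t x : 0 <= t -> 0 < x ->
  `|bgf_rem t x - bernoulli2 t / 2| <= bgf_taylor_bound t * x.
Proof.
move=> t0 x0; have x20 : 0 < x ^+ 2 by exact: exprn_gt0.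
have -> : bgf_rem t x - bernoulli2 t / 2 =
    (bgf t x - (1 - (t - 2^-1) * x + bernoulli2 t / 2 * x ^+ 2)) / x ^+ 2.
  by rewrite /bgf_rem; field; rewrite gt_eqF.
rewrite normrM normfV (gtr0_norm x20) ler_pdivrMr//.
rewrite (_ : _ * x * x ^+ 2 = bgf_taylor_bound t * x ^+ 3); last by ring.
exact: bgf_taylor.
Qed.

Lemma bgf_rem_continuous t x : 0 < x -> {for x, continuous (bgf_rem t)}.
Proof.
move=> x0; apply: cvgM.
  apply: cvgD; last by apply: cvgM; [exact: cvg_cst|exact: cvg_id].
  by apply: cvgB; [exact: bgf_continuous|exact: cvg_cst].
apply: cvgV; first by rewrite expf_eq0/= gt_eqF.
exact: exprn_continuous.
Qed.

Definition binet_int t l : R := laplace_int (bgf_rem t) l.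

Lemma binet_int_asymp t l : 0 <= t -> 0 < l ->
  has_integral (fun x => expR (- l * x) * bgf_rem t x) (binet_int t l) /\
  `|binet_int t l - bernoulli2 t / 2 / l| <= 4 * bgf_taylor_bound t / l ^+ 2.
Proof.
move=> t0; apply: watson; last by move=> x; exact: bgf_rem_near.
by apply: measurable_of_continuous_pos => x; exact: bgf_rem_continuous.
Qed.

(** The factor 1 - e^{-x} produced by the shift cancels the denominator of [bgf]. What remains is a
    sum of Frullani integrands, with e^{-(l+1)x} / x added and subtracted so that each of them
    converges. *)
Lemma binet_int_shift t l : 0 < t -> 0 < l ->
  binet_int t l - binet_int t (l + 1) =
  (l + 1 + (t - 2^-1)) * ln (l + 1) - (l + (t - 2^-1)) * ln l - ln (l + t) - 1.
Proof.
move=> t0 l0; have l10 : 0 < l + 1 by rewrite addr_gt0.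
have [i0 _] := binet_int_asymp (ltW t0) l0.
have [i1 _] := binet_int_asymp (ltW t0) l10.
have j1 := frullani_signed (addr_gt0 l0 t0) l10.
have j2 := frullani_second l0.
have j3 := has_integralZ (t - 2^-1) (frullani_signed l0 l10).
have j := has_integralD (has_integralB j1 j2) j3.
apply: etrans (_ : _ = ln (l + 1) - ln (l + t) - (l * ln l - l * ln (l + 1) + 1) +
   (t - 2^-1) * (ln (l + 1) - ln l)) _; last by ring.
apply: has_integral_unique (has_integralB i0 i1) _.
apply: has_integral_ext j => x x0.
have E1 : expR (- (l + 1) * x) = expR (- l * x) * expR (- x) by rewrite -expRD; congr expR; ring.
have E2 : expR (- (l + t) * x) = expR (- l * x) * expR (- t * x).
  by rewrite -expRD; congr expR; ring.
rewrite E1 E2 /bgf_rem /bgf; field.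
by rewrite !gt_eqF//= onem_expRN_gt0.
Qed.

(* [E t] is 1-periodic and varies by O(1/x) over [[x, x + 1]], so it is constant. *)
Let E t l := lngamma (l + t) - (l + (t - 2^-1)) * ln l + l - binet_int t l.

Let E_periodic t l : 0 < t -> 0 < l -> E t (l + 1) = E t l.
Proof.
move=> t0 l0; have := binet_int_shift t0 l0.
rewrite /E (addrAC l 1 t) lngammaS ?addr_gt0//; lra.
Qed.

Let E_periodicn t l n : 0 < t -> 0 < l -> E t (l + n%:R) = E t l.
Proof.
move=> t0 l0; elim: n => [|n IH]; first by rewrite addr0.
by rewrite -natr1 addrA E_periodic// ltr_wpDr.
Qed.

(** The terms t and 4 bound the gaps between ln xi and the logarithms given by convexity, |t - 1/2|
    bounds the term in 1/xi, and the last summand bounds the two values of the Binet integral. *)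
Let E_bound t : R :=
  t + 4 + `|t - 2^-1| + 2 * (`|bernoulli2 t / 2| + 4 * bgf_taylor_bound t).

Let E_variation t x h : 0 < t -> 2 <= x -> 0 <= h <= 1 ->
  `|E t (x + h) - E t x| <= E_bound t / x.
Proof.
move=> t0 x2 /andP[h0 h1]; have x0 : 0 < x by apply: lt_le_trans x2.
set s := t - 2^-1; set b := bernoulli2 t / 2; set C := bgf_taylor_bound t.
have C0 : 0 <= C.
  rewrite /C /bgf_taylor_bound; have := exprn_ge0 3 (ltW t0).
  have := normr_ge0 (t - 2^-1); have := normr_ge0 (bernoulli2 t / 2); lra.
have W y : x <= y -> `|binet_int t y| <= (`|b| + 4 * C) / x.
  move=> xy; have y0 := lt_le_trans x0 xy.
  have [_ H] := binet_int_asymp (ltW t0) y0; rewrite -/b -/C in H.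
  rewrite -(subrK (b / y) (binet_int t y)) (le_trans (ler_normD _ _))//.
  rewrite mulrDl addrC lerD//.
    by rewrite normrM normfV (gtr0_norm y0) ler_wpM2l// lef_pV2.
  apply: le_trans H _; rewrite ler_wpM2l ?mulr_ge0// lef_pV2 ?posrE ?exprn_gt0//.
  apply: (le_trans xy); rewrite expr2 ler_peMl ?(ltW y0)//.
  by apply: le_trans _ (le_trans x2 xy); rewrite ler1n.
(* The elementary terms change by h (ln xi + s / xi), while convexity places the change of ln Gamma
   between h ln(x + t - 1) and h ln(x + t). All these logarithms agree up to O(1/x). *)
have [xi xix PE] : exists2 xi, x <= xi <= x + h &
    ((x + h + s) * ln (x + h) - (x + h)) - ((x + s) * ln x - x) = h * (ln xi + s / xi).
  have [|y||xi xi_in e] := @MVT_segment R (fun y => (y + s) * ln y - y)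
      (fun y => ln y + s / y) x (x + h).
  - by rewrite lerDl.
  - rewrite in_itv/= => /andP[xy _]; have y0 := lt_trans x0 xy.
    have ? := is_derive1_ln y0; apply: is_derive_eq; rewrite /GRing.scale/=.
    by field; rewrite gt_eqF.
  - apply: derivable_within_continuous => y; rewrite in_itv/= => /andP[xy _].
    have ? := is_derive1_ln (lt_le_trans x0 xy); exact: ex_derive.
  by exists xi; rewrite ?in_itv/= in xi_in *; rewrite // e; ring.
have xi0 : 0 < xi by case/andP: xix => + _; exact: lt_le_trans.
have sxi : `|s / xi| <= `|s| / x.
  rewrite normrM normfV (gtr0_norm xi0) ler_wpM2l// lef_pV2//.
  by case/andP: xix.
have up := @lngamma_slope_le R (x + t) h (addr_gt0 x0 t0).
rewrite h0 h1 in up; have {}up := up isT.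
have xt1 : 1 < x + t by rewrite ltr_pwDr//; lra.
have lo := lngamma_slope_geS xt1 h0.
have l1 : ln (x + t) - ln xi <= t / x.
  apply: (@le_trans _ _ (ln (x + t) - ln x)).
    by rewrite lerD2l lerN2 ler_ln ?posrE//; case/andP: xix.
  rewrite -ln_div ?posrE ?addr_gt0// mulrDl divff ?gt_eqF//.
  have q0 : 0 < t / x by rewrite divr_gt0.
  by apply: le_ln1Dx; lra.
have x10 : 0 < x - 1 by lra.
have xi1 : xi <= x + 1 by case/andP: xix; lra.
have l2 : ln xi - ln (x + t - 1) <= 4 / x.
  apply: (@le_trans _ _ (ln (x + 1) - ln (x - 1))).
    by apply: lerB; rewrite ler_ln ?posrE//; lra.
  have x1p : 0 < x + 1 by rewrite addr_gt0.
  rewrite -ln_div ?posrE//.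
  have -> : (x + 1) / (x - 1) = 1 + 2 / (x - 1) by field; rewrite gt_eqF.
  have q0 : 0 < 2 / (x - 1) by rewrite divr_gt0.
  apply: (@le_trans _ _ (2 / (x - 1))); first by apply: le_ln1Dx; lra.
  by rewrite ler_pdivrMr// mulrAC ler_pdivlMr//; lra.
have Wx := W x (lexx _); have Wxh : `|binet_int t (x + h)| <= (`|b| + 4 * C) / x.
  by apply: W; rewrite lerDl.
rewrite [X in `|X|](_ : _ = (lngamma (x + t + h) - lngamma (x + t))
   - h * (ln xi + s / xi) - binet_int t (x + h) + binet_int t x); last first.
  by rewrite -PE /E (addrAC x h t) -/s; ring.
have -> : E_bound t / x = t / x + 4 / x + `|s| / x + 2 * ((`|b| + 4 * C) / x).
  by rewrite /E_bound -/s -/b -/C; ring.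
move: Wx Wxh sxi; rewrite !ler_norml => /andP[? ?] /andP[? ?] /andP[? ?].
have tx0 : 0 <= t / x by rewrite divr_ge0 ?(ltW t0) ?(ltW x0).
have x40 : 0 <= 4 / x by rewrite divr_ge0 ?(ltW x0).
have sx0 : 0 <= `|s| / x by rewrite divr_ge0 ?(ltW x0).
have u1 : h * (ln (x + t) - ln xi - s / xi) <= t / x + `|s| / x.
  apply: (@le_trans _ _ (h * (t / x + `|s| / x))); first by rewrite ler_wpM2l//; lra.
  by rewrite ler_piMl// addr_ge0.
have u2 : h * (ln xi - ln (x + t - 1) + s / xi) <= 4 / x + `|s| / x.
  apply: (@le_trans _ _ (h * (4 / x + `|s| / x))); first by rewrite ler_wpM2l//; lra.
  by rewrite ler_piMl// addr_ge0.
apply/andP; split; lra.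
Qed.

(** The constant is the common value of [E t]. Translating by n leaves the increment of [E t]
    unchanged and divides its bound by 1 + n. *)
Lemma binet_formula t : 0 < t -> exists C, forall l, 0 < l ->
  lngamma (l + t) = (l + (t - 2^-1)) * ln l - l + C + binet_int t l.
Proof.
move=> t0; exists (E t 1) => l l0.
suff : E t l = E t 1 by rewrite {1}/E; lra.
have E1 h : 0 <= h <= 1 -> E t (1 + h) = E t 1.
  move=> h01; have /andP[h0 h1] := h01.
  apply/eqP; rewrite -subr_eq0 -normr_le0; apply/ler_addgt0Pr => e e0.
  rewrite add0r.
  pose n := (Num.truncn (E_bound t / e)).+1.
  have B0 : 0 <= E_bound t.
    rewrite /E_bound /bgf_taylor_bound; have := exprn_ge0 3 (ltW t0).
    have := normr_ge0 (t - 2^-1); have := normr_ge0 (bernoulli2 t / 2); lra.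
  have := @E_variation t (1 + n%:R) h t0 _ h01.
  rewrite (addrAC 1 n%:R h) !E_periodicn ?ltr_wpDr// => H.
  have n2 : 2 <= 1 + n%:R :> R by rewrite (_ : 2 = 1 + 1)// lerD2l ler1n.
  apply: (le_trans (H n2)); rewrite ler_pdivrMr ?ltr_wpDr// mulrC -ler_pdivrMr//.
  by rewrite (le_trans (ltW (truncnS_gt _)))// lerDr.
have l0' := ltW l0; have /andP[nl nl1] := truncn_itv l0'; rewrite -natr1 in nl1.
(* One extra period lets l + 1 be written as 1 plus the fractional part plus the integer part, with
   a base point that is positive even when l is an integer. *)
rewrite -E_periodic//.
have -> : l + 1 = 1 + (l - (Num.truncn l)%:R) + (Num.truncn l)%:R by ring.
rewrite E_periodicn ?E1//.
  by rewrite subr_ge0 nl/= lerBlDl ltW.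
by rewrite ltr_wpDr// subr_ge0.
Qed.

End binet.

(** * Gamma laws *)

Section dilation.
Variable R : realType.
Local Notation leb := (@lebesgue_measure R).
Local Notation Rp := (`]0, +oo[%classic : set R).
Implicit Types (a v : R) (f : R -> R).

Definition dilation a : measurableTypeR R -> measurableTypeR R := fun x : R => a * x.

Lemma measurable_dilation a : measurable_fun [set: measurableTypeR R] (dilation a).
Proof. exact: (@measurable_funM _ _ R setT (cst a) id). Qed.

HB.instance Definition _ a :=
  isMeasurableFun.Build _ _ _ _ (dilation a) (measurable_dilation a).

Definition dilated_lebesgue a : {measure set (measurableTypeR R) -> \bar R} :=
  measure_function_pushforward__canonical__measure_function_Measure
    leb (measurable_dilation a).

Lemma lebesgue_measure_dilation (a : {posnum R}) (A : set R) : measurable A ->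
  lebesgue_measure A = mscale a%:num%:nng (dilated_lebesgue a%:num) A.
Proof.
move=> mA; apply: lebesgue_measure_unique => //= _ [[x y]] _ <-.
rewrite /mscale/= /dilated_lebesgue/= /pushforward (_ : dilation a%:num @^-1` `]x, y]%classic =
  `](x / a%:num), (y / a%:num)]%classic); last first.
  apply/seteqP; split => z; rewrite /= /dilation !in_itv/= ltr_pdivrMr// ler_pdivlMr//.
    by rewrite mulrC.
  by rewrite mulrC.
rewrite !lebesgue_measure_itv/= !lte_fin ltr_pM2r ?invr_gt0//.
case: ifPn => _; last by rewrite mule0.
by rewrite -!EFinB -EFinM; congr EFin; field; rewrite gt_eqF.
Qed.

Lemma ge0_integral_dilation a f : 0 < a -> measurable_fun Rp f ->
  (forall x, 0 < x -> 0 <= f x) ->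
  (\int[leb]_(x in Rp) (f x)%:E = a%:E * \int[leb]_(x in Rp) (f (a * x))%:E)%E.
Proof.
move=> a0 mf f0; pose a' := PosNum a0.
rewrite (@eq_measure_integral _ _ _ _ (mscale a'%:num%:nng (dilated_lebesgue a'%:num))); last first.
  by move=> A mA _; exact: lebesgue_measure_dilation.
rewrite ge0_integral_mscale//.
- congr (_ * _)%E; rewrite ge0_integral_pushforward//.
  + rewrite (_ : dilation a @^-1` Rp = Rp)//; apply/seteqP.
    by split => x; rewrite /= /dilation !in_itv/= !andbT pmulr_rgt0.
  + exact/measurable_EFinP.
  + by move=> x; rewrite inE/= in_itv/= andbT lee_fin => /f0.
- exact/measurable_EFinP.
- by move=> x; rewrite /= in_itv/= andbT lee_fin => /f0.
Qed.

(** The change of variables is known for nonnegative functions; a signed f is handled as (f + |f|) -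
    |f|. *)
Lemma has_integral_dilation a f v : 0 < a ->
  has_integral f v -> has_integral (fun x => f (a * x)) (v / a).
Proof.
have ge0_case a' f' v' : 0 < a' -> measurable_fun Rp f' -> (forall x, 0 < x -> 0 <= f' x) ->
    has_integral f' v' -> has_integral (fun x => f' (a' * x)) (v' / a').
  move=> a0 mf f0 [_ fv]; apply: has_integral_ge0.
  - apply: (measurable_comp (measurable_itv `]0, +oo[) _ mf).
      by move=> _ [x /= + <-]; rewrite !in_itv/= !andbT => x0; rewrite mulr_gt0.
    exact: measurable_funM.
  - by move=> x x0; rewrite f0// mulr_gt0.
  - have := ge0_integral_dilation a0 mf f0; rewrite fv.
    set I := (\int[leb]_(x in Rp) (f' (a' * x))%:E)%E; case: I => [r| |].
    + by rewrite -EFinM => -[->]; congr EFin; field; rewrite gt_eqF.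
    + by rewrite gt0_muley ?lte_fin.
    + by rewrite gt0_muleNy ?lte_fin.
move=> a0 fi; have [fint _] := fi.
have mf : measurable_fun Rp f by move/measurable_int: fint => /measurable_EFinP.
have mnf : measurable_fun Rp (fun x => `|f x|) by exact: measurableT_comp.
have nint : leb.-integrable Rp (EFin \o (fun x => `|f x|)) by exact: integrable_norm.
pose V := fine (\int[leb]_(x in Rp) (`|f x|)%:E)%E.
have ni : has_integral (fun x => `|f x|) V.
  split => //; rewrite fineK//.
  exact: (@integrable_fin_num _ _ _ leb Rp (measurable_itv _) _ nint).
have si := has_integralD fi ni.
have h1 : has_integral (fun x => `|f (a * x)|) (V / a) by apply: (ge0_case a (fun x => `|f x|)).
have h2 : has_integral (fun x => f (a * x) + `|f (a * x)|) ((v + V) / a).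
  apply: (ge0_case a (fun x => f x + `|f x|)) => //; first exact: measurable_funD.
  by move=> x _; have := ler_norm (- f x); rewrite normrN; lra.
have := has_integralB h2 h1; rewrite mulrDl addrK.
by apply: has_integral_ext => x _; rewrite addrK.
Qed.

End dilation.

Section gamma_law.
Variable R : realType.
Local Notation leb := (@lebesgue_measure R).
Local Notation Rp := (`]0, +oo[%classic : set R).
Implicit Types (k b l : R).

Lemma has_integral_Gamma_rate k b : 0 < k -> 0 < b ->
  has_integral (fun x => x `^ (k - 1) * expR (- b * x)) (Gamma k * b `^ (- k)).
Proof.
move=> k0 b0; have := has_integralZ (b `^ (1 - k))
  (has_integral_dilation b0 (has_integral_Gamma k0)).
rewrite (_ : _ * (_ / b) = Gamma k * b `^ (- k)).
  apply: has_integral_ext => x x0.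
  rewrite powRM ?ltW// mulrA mulrA -powRD; last by rewrite (gt_eqF b0) implybT.
  by rewrite (_ : 1 - k + (k - 1) = 0) ?powRr0 ?mul1r ?mulNr//; ring.
rewrite powRD; last by rewrite (gt_eqF b0) implybT.
by rewrite powRr1 ?ltW//; field; rewrite gt_eqF.
Qed.

Lemma gamma_law k b : 0 < k -> 0 < b ->
  exists2 nu : probability R R, nonneg_law nu &
    forall l, 0 <= l -> laplace nu l = ((b / (b + l)) `^ k)%:E.
Proof.
move=> k0 b0; have G0 := Gamma_gt0 k0.
pose c := (Gamma k)^-1 * b `^ k.
have c0 : 0 < c by rewrite mulr_gt0 ?invr_gt0// powR_gt0.
pose h := (fun x : R => x `^ (k - 1) * expR (- b * x)).
pose g := ((fun x => c * h x) \_ Rp).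
have mh : measurable_fun Rp (fun x => c * h x).
  apply: measurable_funM => //; apply: measurable_funM; last exact: measurable_expRM.
  by apply: measurable_funTS; exact: measurable_powR.
have g0 x : 0 <= g x.
  by rewrite /g patchE; case: ifPn => // _; rewrite mulr_ge0 ?(ltW c0)//
    /h mulr_ge0 ?powR_ge0 ?expR_ge0.
have gE l : (\int[leb]_x (expR (- l * x) * g x)%:E =
    \int[leb]_(x in Rp) (c * (x `^ (k - 1) * expR (- (b + l) * x)))%:E)%E.
  rewrite [RHS]integral_mkcond; apply: eq_integral => x _; rewrite /g !patchE.
  case: ifPn => _; last by rewrite mulr0.
  congr EFin; rewrite (_ : - (b + l) * x = - l * x + - b * x); last by ring.
  by rewrite expRD /h; ring.
have gi l : 0 <= l -> (\int[leb]_x (expR (- l * x) * g x)%:E = ((b / (b + l)) `^ k)%:E)%E.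
  move=> l0; have bl0 : 0 < b + l by rewrite ltr_wpDr.
  rewrite gE; have [_ ->] := has_integralZ c (has_integral_Gamma_rate k0 bl0).
  congr EFin; rewrite powRM ?invr_ge0 ?ltW// -powR_inv1 ?ltW// -powRrM mulN1r /c.
  by field; rewrite gt_eqF.
have [|||nu nu0 nuL] := @density_law R g _ g0.
- by apply/(measurable_restrictT _ _).1 => //.
- by move=> x x0; rewrite /g patchE memNset//= in_itv/= andbT; apply/negP; rewrite -leNgt ltW.
- have := gi 0 (lexx _); rewrite addr0 divff ?gt_eqF// powR1 => <-.
  by apply: eq_integral => x _; rewrite oppr0 mul0r expR0 mul1r.
by exists nu => // l l0; rewrite nuL gi.
Qed.

End gamma_law.

(** * Self-decomposability *)

Section laplace_monotonicity.
Variable R : realType.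
Implicit Types (mu nu : probability R R) (l m c : R) (L : R -> R).

Lemma laplace0 mu : laplace mu 0 = 1%E.
Proof.
rewrite /laplace; have -> : (\int[mu]_x (expR (- 0 * x))%:E = \int[mu]_x (cst 1%E) x)%E.
  by apply: eq_integral => x _; rewrite oppr0 mul0r expR0.
by rewrite integral_cst// mul1e; exact: probability_setT.
Qed.

Lemma measurable_laplace_integrand l : measurable_fun [set: R] (fun x : R => (expR (- l * x))%:E).
Proof. by apply/measurable_EFinP; exact: measurable_expRM. Qed.

Lemma laplace_nincr mu l m : nonneg_law mu -> l <= m -> (laplace mu m <= laplace mu l)%E.
Proof.
move=> mu0 lm; rewrite /laplace !nonneg_law_integral//.
- apply: ge0_le_integral => //.
  + by apply: measurable_funTS; exact: measurable_laplace_integrand.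
  + by apply: measurable_funTS; exact: measurable_laplace_integrand.
  + move=> x; rewrite /= in_itv/= andbT => x0.
    by rewrite lee_fin ler_expR ler_wpM2r// lerN2.
- exact: measurable_laplace_integrand.
- exact: measurable_laplace_integrand.
Qed.

Lemma laplace_convex nu (w l m : R) : 0 <= w <= 1 ->
  (laplace nu ((1 - w) * l + w * m) <= (1 - w)%:E * laplace nu l + w%:E * laplace nu m)%E.
Proof.
move=> w01; have /andP[w0 w1] := w01; have w1' : 0 <= 1 - w by rewrite subr_ge0.
have me := measurable_laplace_integrand.
have e0 k (x : R) : (0 <= (expR (- k * x))%:E)%E by rewrite lee_fin expR_ge0.
rewrite /laplace -!ge0_integralZl_EFin// -ge0_integralD//.
- apply: ge0_le_integral => //.
  + by apply: emeasurable_funD; apply: emeasurable_funM.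
  + move=> x _; rewrite -!EFinM -EFinD lee_fin.
    apply: le_trans (expR_convex _ _ w01); rewrite ler_expR le_eqVlt.
    by apply/orP; left; apply/eqP; ring.
- by move=> x _; rewrite mule_ge0.
- by apply: emeasurable_funM.
- by move=> x _; rewrite mule_ge0.
- by apply: emeasurable_funM.
Qed.

(* The ratio is the Laplace transform of the cofactor; the latter is not assumed to
   be nonnegative, but its transform is convex and bounded by 1, hence nonincreasing. *)
Lemma selfdecomposable_ratio mu L c : nonneg_law mu -> selfdecomposable mu ->
  (forall l, 0 <= l -> laplace mu l = (L l)%:E) -> (forall l, 0 <= l -> 0 < L l) ->
  0 < c < 1 -> forall l m, 0 <= l -> l < m -> L m / L (c * m) <= L l / L (c * l).
Proof.
move=> mu0 sd muL L0 c01 l m l0 lm; have [c0 c1] := andP c01.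
have [nu nuE] := sd c c01; pose N k := L k / L (c * k).
have nuN k : 0 <= k -> laplace nu k = (N k)%:E.
  move=> k0; have ck0 : 0 <= c * k by rewrite mulr_ge0// ltW.
  have := laplace_affine_law c mu nu k.
  have -> : laplace (affine_law c mu nu) k = laplace mu k.
    by apply: eq_measure_integral => A mA _; exact/esym/nuE.
  rewrite !muL//; have Lck := L0 _ ck0.
  have : (0 <= laplace nu k)%E by apply: integral_ge0 => x _; rewrite lee_fin expR_ge0.
  case: (laplace nu k) => [r| |] // _.
    by rewrite -EFinM => -[E]; congr EFin; rewrite /N E; field; rewrite gt_eqF.
  by rewrite gt0_muley// lte_fin.
have N1 k : 0 <= k -> N k <= 1.
  move=> k0; have ck0 : 0 <= c * k by rewrite mulr_ge0// ltW.
  rewrite /N ler_pdivrMr ?L0// mul1r -lee_fin -!muL//; apply: laplace_nincr => //.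
  by rewrite ler_piMl// ltW.
apply/ler_addgt0Pr => e e0; rewrite -!/(N _).
have ml0 : 0 < m - l by rewrite subr_gt0.
(* The transform N is convex and at most 1. The far point [T] makes m the barycentre of l and [T]
   with weight w on [T], whence N(m) <= N(l) + w <= N(l) + e. *)
pose w := Num.min 1 e; have w0 : 0 < w by rewrite lt_min ltr01 e0.
have w1 : w <= 1 by rewrite ge_min lexx.
pose T := l + (m - l) / w.
have T0 : 0 <= T by rewrite addr_ge0// divr_ge0 ?(ltW ml0) ?(ltW w0).
have mE : m = (1 - w) * l + w * T by rewrite /T; field; rewrite gt_eqF.
have w01 : 0 <= w <= 1 by rewrite w1 ltW.
have := @laplace_convex nu w l T w01; rewrite -mE !nuN ?(le_trans l0 (ltW lm))//.
rewrite -!EFinM -EFinD lee_fin => /le_trans; apply.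
rewrite lerD//.
  rewrite ler_piMl ?gerBl ?(ltW w0)// /N.
  by rewrite divr_ge0// ltW// L0// mulr_ge0// ltW.
rewrite (@le_trans _ _ w)//; first by rewrite ler_piMr ?(ltW w0)// N1.
by rewrite ge_min lexx orbT.
Qed.

End laplace_monotonicity.

Section levy_density_law.
Variable R : realType.
Local Notation leb := (@lebesgue_measure R).
Local Notation Rp := (`]0, +oo[%classic : set R).

(** The transform of m is available for l > 0 only. Monotone convergence along l = 1/(n + 1)
    identifies the total mass of m with the limit [V0] and thereby proves it finite. *)
Lemma levy_density_law (m V : R -> R) (V0 : R) : measurable_fun Rp m ->
  (forall x, 0 < x -> 0 <= m x) ->
  (forall l, 0 < l -> has_integral (fun x => expR (- l * x) * m x) (V l)) ->
  (V n.+1%:R^-1 @[n --> \oo] --> V0) ->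
  exists2 nu : probability R R, nonneg_law nu &
    forall l, 0 < l -> laplace nu l = (expR (V l - V0))%:E.
Proof.
move=> mm m0 mV VV0; pose g := m \_ Rp.
have gE (f : R -> R) : (\int[leb]_x (f x * g x)%:E = \int[leb]_(x in Rp) (f x * m x)%:E)%E.
  rewrite [RHS]integral_mkcond; apply: eq_integral => x _; rewrite /g !patchE.
  by case: ifPn => _ //; rewrite mulr0.
have mint : (\int[leb]_(x in Rp) (m x)%:E = V0%:E)%E.
  have nd x : 0 < x ->
      {homo (fun n => expR (- (n.+1%:R^-1 : R) * x)) : i j / (i <= j)%N >-> i <= j}.
    move=> x0 i j ij; rewrite ler_expR ler_pM2r// lerN2 lef_pV2 ?posrE//.
    by rewrite ler_nat ltnS.
  have pos n : 0 < n.+1%:R^-1 :> R by rewrite invr_gt0.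
  have := @cvg_monotone_convergence _ _ _ leb Rp (measurable_itv _)
    (fun n x => (expR (- (n.+1%:R^-1 : R) * x) * m x)%:E).
  have -> : (fun n => \int[leb]_(x in Rp) (expR (- (n.+1%:R^-1 : R) * x) * m x)%:E)%E =
      (fun n => (V (n.+1%:R^-1))%:E).
    by apply/funext => n; have [_ ->] := mV _ (pos n).
  have -> : (\int[leb]_(x in Rp) limn (fun n => (expR (- (n.+1%:R^-1 : R) * x) * m x)%:E) =
             \int[leb]_(x in Rp) (m x)%:E)%E.
    apply: eq_integral => x _; apply/cvg_lim => //.
    apply: cvg_EFin; first exact: nearW.
    rewrite [X in _ --> X](_ : m x = expR (- 0 * x) * m x); last first.
      by rewrite oppr0 mul0r expR0 mul1r.
    apply: cvgM; last exact: cvg_cst.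
    apply: continuous_cvg; first exact: continuous_expR.
    apply: cvgM; last exact: cvg_cst.
    apply: cvgN; exact: cvg_harmonic.
  move=> cv; have {}cv := cv (fun n => _) (fun n => _) (fun x => _).
  apply: (@cvg_unique _ (@ereal_hausdorff R) _ _ _ _ (cv _ _ _)).
  - by move=> n; apply/measurable_EFinP; apply: measurable_funM => //; exact: measurable_expRM.
  - by move=> n x; rewrite /= in_itv/= andbT => x0; rewrite lee_fin mulr_ge0 ?expR_ge0 ?m0.
  - move=> x; rewrite /= in_itv/= andbT => x0 i j ij.
    by rewrite lee_fin ler_wpM2r ?m0// nd.
  - by apply: cvg_EFin => //; exact: nearW.
have [||||nu nu0 nuL] := @finite_levy_law R g V0.
- by apply/(measurable_restrictT _ _).1.
- by move=> x; rewrite /g patchE; case: ifPn => //; rewrite inE/= in_itv/= andbT => /m0.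
- by move=> x x0; rewrite /g patchE memNset//= in_itv/= andbT; apply/negP; rewrite -leNgt ltW.
- by rewrite -mint [RHS]integral_mkcond; apply: eq_integral => x _; rewrite /g !patchE; case: ifPn.
exists nu => // l l0; apply: nuL; first exact: ltW.
by rewrite (gE (fun x => expR (- l * x))); have [_ ->] := mV l l0.
Qed.

End levy_density_law.

(** * The Levy density without its singular part, and the transform of what remains *)

Section levy_remainder.
Variable R : realType.
Variables t a b w : R.
Hypotheses (t_gt0 : 0 < t) (a_gt0 : 0 < a) (ab : a < b) (w_gt0 : 0 < w).
Implicit Types (l x y d A : R).

Let b_gt0 : 0 < b. Proof. exact: lt_trans ab. Qed.

(* The Levy density is [canonical_fun x / x]. *)
Definition canonical_fun x : R := w * (bgf t (a * x) - bgf t (b * x)) / x.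

Definition canonical_fun0 : R := w * (b - a) * (t - 2^-1).

(** This is (k(x) - k0) / x, written with dilated Binet integrands so that its transform is a
    combination of two Binet integrals. *)
Definition levy_rem x : R :=
  w * (a ^+ 2 * bgf_rem t (a * x) - b ^+ 2 * bgf_rem t (b * x)).

Definition levy_int l : R := w * (a * binet_int t (l / a) - b * binet_int t (l / b)).

Lemma levy_remE x : 0 < x -> levy_rem x = (canonical_fun x - canonical_fun0) / x.
Proof.
move=> x0; rewrite /levy_rem /bgf_rem /canonical_fun /canonical_fun0.
by field; rewrite !gt_eqF.
Qed.

Lemma levy_rem_continuous x : 0 < x -> {for x, continuous levy_rem}.
Proof.
move=> x0; have cd d : 0 < d -> {for x, continuous (fun y => bgf_rem t (d * y))}.
  move=> d0; apply: (@continuous_comp _ _ _ (fun y => d * y) (bgf_rem t)).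
    by apply: cvgM; [exact: cvg_cst|exact: cvg_id].
  by apply: bgf_rem_continuous; rewrite mulr_gt0.
apply: cvgM; first exact: cvg_cst.
by apply: cvgB; apply: cvgM; by [exact: cvg_cst|exact: cd].
Qed.

Lemma has_integral_levy_rem l : 0 < l ->
  has_integral (fun x => expR (- l * x) * levy_rem x) (levy_int l).
Proof.
move=> l0; have piece d : 0 < d ->
    has_integral (fun x => d ^+ 2 * (expR (- l * x) * bgf_rem t (d * x)))
      (d * binet_int t (l / d)).
  move=> d0; have ld0 : 0 < l / d by rewrite divr_gt0.
  have [i _] := binet_int_asymp (ltW t_gt0) ld0.
  have := has_integralZ (d ^+ 2) (has_integral_dilation d0 i).
  rewrite (_ : d ^+ 2 * (_ / d) = d * binet_int t (l / d)); last by field; rewrite gt_eqF.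
  apply: has_integral_ext => x x0; congr (_ * (expR _ * _)); field; by rewrite gt_eqF.
have := has_integralZ w (has_integralB (piece a a_gt0) (piece b b_gt0)).
by apply: has_integral_ext => x x0; rewrite /levy_rem; ring.
Qed.

(** The coefficient of 1/l at infinity, inherited from the value B_2(t)/2 of the Binet integrand at
    0+. Since 0 < a < b and w > 0, its sign is opposite to that of B_2(t). *)
Definition levy_int_coef : R := w * (a ^+ 2 - b ^+ 2) * (bernoulli2 t / 2).

Definition levy_int_bound : R := w * (a ^+ 3 + b ^+ 3) * (4 * bgf_taylor_bound t).

Lemma levy_int_asymp l : 0 < l ->
  `|levy_int l - levy_int_coef / l| <= levy_int_bound / l ^+ 2.
Proof.
move=> l0; have piece d : 0 < d ->
    `|d * binet_int t (l / d) - d ^+ 2 * (bernoulli2 t / 2) / l| <=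
      d ^+ 3 * (4 * bgf_taylor_bound t) / l ^+ 2.
  move=> d0; have ld0 : 0 < l / d by rewrite divr_gt0.
  have [_ H] := binet_int_asymp (ltW t_gt0) ld0.
  have -> : d * binet_int t (l / d) - d ^+ 2 * (bernoulli2 t / 2) / l =
            d * (binet_int t (l / d) - bernoulli2 t / 2 / (l / d)).
    by field; rewrite !gt_eqF.
  have -> : d ^+ 3 * (4 * bgf_taylor_bound t) / l ^+ 2 =
            d * (4 * bgf_taylor_bound t / (l / d) ^+ 2).
    by field; rewrite !gt_eqF.
  by rewrite normrM (gtr0_norm d0) ler_pM2l.
have -> : levy_int l - levy_int_coef / l =
    w * ((a * binet_int t (l / a) - a ^+ 2 * (bernoulli2 t / 2) / l) -
         (b * binet_int t (l / b) - b ^+ 2 * (bernoulli2 t / 2) / l)).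
  by rewrite /levy_int /levy_int_coef; field; rewrite !gt_eqF.
have -> : levy_int_bound / l ^+ 2 =
    w * (a ^+ 3 * (4 * bgf_taylor_bound t) / l ^+ 2 + b ^+ 3 * (4 * bgf_taylor_bound t) / l ^+ 2).
  by rewrite /levy_int_bound; field; rewrite gt_eqF.
rewrite normrM (gtr0_norm w_gt0) ler_pM2l// (le_trans (ler_normB _ _))//.
by rewrite lerD ?piece.
Qed.

(** In d ln Gamma(l/d + t) the terms l ln l and -l do not depend on d, so the difference cancels
    them. What is linear in l is later removed by the power of alpha in [G]. *)
Lemma lngamma_ratio_formula : exists A, forall l, 0 < l ->
  w * (a * lngamma (l / a + t) - b * lngamma (l / b + t)) =
  w * (ln b - ln a) * l + (A - canonical_fun0 * ln l + levy_int l).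
Proof.
have [C CE] := binet_formula t_gt0.
exists (w * ((a - b) * C - (t - 2^-1) * (a * ln a - b * ln b))) => l l0.
have piece d : 0 < d -> d * lngamma (l / d + t) =
    (l + d * (t - 2^-1)) * (ln l - ln d) - l + d * C + d * binet_int t (l / d).
  move=> d0; rewrite CE ?divr_gt0// ln_div ?posrE//.
  by field; rewrite gt_eqF.
by rewrite !piece// /levy_int /canonical_fun0; ring.
Qed.

End levy_remainder.

(** * Selfdecomposability of a law whose exponent has this form *)

Section selfdecomposability_criterion.
Variable R : realType.
Variables t a b w A K : R.
Variable L : R -> R.
Hypotheses (t_gt0 : 0 < t) (a_gt0 : 0 < a) (ab : a < b) (w_gt0 : 0 < w).
Implicit Types (l m x c d k : R).

Let b_gt0 : 0 < b. Proof. exact: lt_trans ab. Qed.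

Local Notation kappa := (canonical_fun t a b w).
Local Notation kappa0 := (canonical_fun0 t a b w).
Local Notation rho := (levy_rem t a b w).
Local Notation rho_int := (levy_int t a b w).
Local Notation Rp := (`]0, +oo[%classic : set R).

Let exponent l := A - kappa0 * ln l + rho_int l.

Hypothesis L_at0 : L 0 = 1.
Hypothesis LE : forall l, 0 < l -> L l = expR (exponent l).
(** Near 0 the logarithm and [rho_int] can each diverge; this bound says that with the constant A
    they compensate. It provides the limits at l = 0 that give the total masses. *)
Hypothesis exponent_lipschitz0 : forall l, 0 < l <= 1 -> `|exponent l| <= K * l.

Let L_gt0 l : 0 <= l -> 0 < L l.
Proof.
by rewrite le_eqVlt => /predU1P[<-|l0]; rewrite ?L_at0// LE// expR_gt0.
Qed.

Let exponent_cvg0 c : 0 < c <= 1 -> exponent (c * n.+1%:R^-1) @[n --> \oo] --> (0 : R).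
Proof.
move=> /andP[c0 c1].
have cvgKc k : k * n.+1%:R^-1 @[n --> \oo] --> (0 : R).
  by rewrite -(mulr0 k); apply: cvgM; [exact: cvg_cst|exact: cvg_harmonic].
apply: (@squeeze_cvgr _ _ _ _ (fun n => - (K * c) * n.+1%:R^-1)
  (fun n => K * c * n.+1%:R^-1)) => //.
apply: nearW => n; rewrite mulNr -ler_norml -mulrA; apply: exponent_lipschitz0.
rewrite mulr_gt0 ?invr_gt0//= mulr_ile1 ?invr_ge0 ?(ltW c0)//.
by rewrite invf_le1// ler1n.
Qed.

Let measurable_rho_scaled c : 0 < c -> measurable_fun Rp (fun x => rho (c * x)).
Proof.
move=> c0; apply: measurable_of_continuous_pos => x x0.
apply: (@continuous_comp _ _ _ (fun y => c * y) rho).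
  by apply: cvgM; [exact: cvg_cst|exact: cvg_id].
by apply: levy_rem_continuous; rewrite ?mulr_gt0.
Qed.

Let measurable_rho : measurable_fun Rp rho.
Proof. by apply: measurable_of_continuous_pos => x x0; exact: levy_rem_continuous. Qed.

(** The density is (k(x) - k(x/c)) / x, nonnegative by [bgf_dilation]. The constant k0 drops out,
    which makes the mass finite, equal to -k0 ln c. *)
Let cofactor_law c : t0 R <= t -> 0 < c < 1 ->
  exists2 nu : probability R R, nonneg_law nu &
    forall l, 0 < l -> laplace nu l = (L l / L (c * l))%:E.
Proof.
move=> tt0 /andP[c0 c1]; have ci0 : 0 < c^-1 by rewrite invr_gt0.
have [||l l0||nu nu0 nuE] := @levy_density_law R
  (fun x => rho x - c^-1 * rho (c^-1 * x))
  (fun l => rho_int l - rho_int (c * l)) (- kappa0 * ln c).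
- apply: measurable_funB.
    exact: measurable_rho.
  by apply: measurable_funM => //; exact: measurable_rho_scaled.
- move=> x x0; have cx0 : 0 < c^-1 * x by rewrite mulr_gt0.
  rewrite !levy_remE// /canonical_fun.
  have c01 : 0 < c <= 1 by rewrite c0 ltW.
  have := bgf_dilation tt0 a_gt0 (ltW ab) c01 x0.
  rewrite ![x / c]mulrC -subr_ge0 => H.
  rewrite (_ : _ - _ = w / x ^+ 2 * (bgf t (a * x) - bgf t (b * x) -
    c * (bgf t (a * (c^-1 * x)) - bgf t (b * (c^-1 * x))))).
    by rewrite mulr_ge0// divr_ge0 ?(ltW w_gt0)// exprn_ge0// ltW.
  by field; rewrite !gt_eqF.
- have cl0 : 0 < c * l by rewrite mulr_gt0.
  have i1 := has_integral_levy_rem w t_gt0 a_gt0 ab l0.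
  have := has_integral_dilation ci0 (has_integral_levy_rem w t_gt0 a_gt0 ab cl0).
  move=> /(has_integralZ c^-1)/(has_integralB i1).
  rewrite (_ : c^-1 * (_ / c^-1) = rho_int (c * l)); last by field; rewrite gt_eqF.
  apply: has_integral_ext => x x0.
  rewrite (_ : - (c * l) * (c^-1 * x) = - l * x); last by field; rewrite gt_eqF.
  by ring.
- rewrite (_ : (fun n => _) = (fun n : nat => exponent (1 * n.+1%:R^-1) -
     exponent (c * n.+1%:R^-1) - kappa0 * ln c)); last first.
    apply/funext => n; have n0 : 0 < n.+1%:R^-1 :> R by rewrite invr_gt0.
    by rewrite /exponent mul1r lnM ?posrE//; ring.
  rewrite (_ : - kappa0 * ln c = 0 - 0 - kappa0 * ln c); last by ring.
  apply: cvgB; last exact: cvg_cst.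
  by apply: cvgB; apply: exponent_cvg0; rewrite ?c0 ?ltr01 ?lexx ?(ltW c1).
exists nu => // l l0; have cl0 : 0 < c * l by rewrite mulr_gt0.
rewrite nuE// !LE// -expRB; congr (expR _)%:E.
by rewrite /exponent lnM ?posrE//; ring.
Qed.

(* A gamma law of shape [kappa0] and rate [r] carries the non-integrable part
   [kappa0 * expR (- r * x) / x] of the Levy density. *)
Let law_exists : t0 R <= t -> exists2 mu : probability R R, nonneg_law mu &
  forall l, 0 <= l -> laplace mu l = (L l)%:E.
Proof.
move=> tt0; have th : 2^-1 < t.
  by apply: lt_le_trans tt0; rewrite /t0 ltrDl invr_gt0 mulr_gt0// sqrtr_gt0.
have s0 : 0 < t - 2^-1 by rewrite subr_gt0.
have k0 : 0 < kappa0 by rewrite /canonical_fun0 !mulr_gt0// subr_gt0.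
(* The decay rate in [bgf_diff_ge]: with it, removing the gamma part leaves a nonnegative
   density. *)
pose r := (t - 2^-1) * b + a / 2.
have r0 : 0 < r by rewrite addr_gt0 ?divr_gt0// mulr_gt0.
(* The transform of the rest is [exponent l] - A + k0 ln(l + r), whose limit at l = 0 is the total
   mass - A + k0 ln r. *)
have [||l l0||nu nu0 nuE] := @levy_density_law R
  (fun x => rho x + kappa0 * ((1 - expR (- r * x)) / x))
  (fun l => rho_int l + kappa0 * (ln (l + r) - ln l)) (- A + kappa0 * ln r).
- apply: measurable_funD.
    exact: measurable_rho.
  apply: measurable_funM => //; apply: measurable_funM; last exact: measurable_inv_pos.
  by apply: measurable_funB => //; exact: measurable_expRM.
- move=> x x0; rewrite levy_remE//.
  have := bgf_diff_ge (ltW th) a_gt0 (ltW ab) x0.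
  rewrite -subr_ge0 => H.
  rewrite (_ : _ + _ = w / x ^+ 2 * (bgf t (a * x) - bgf t (b * x) -
    (t - 2^-1) * (b - a) * x * expR (- r * x))).
    by rewrite mulr_ge0// divr_ge0 ?(ltW w_gt0)// exprn_ge0// ltW.
  by rewrite /canonical_fun /canonical_fun0; field; rewrite !gt_eqF.
- have lr0 : 0 < l + r by rewrite addr_gt0.
  have := has_integralD (has_integral_levy_rem w t_gt0 a_gt0 ab l0)
    (has_integralZ kappa0 (frullani_signed l0 lr0)).
  apply: has_integral_ext => x x0.
  by rewrite (_ : - (l + r) * x = - l * x + - r * x) ?expRD; ring.
- rewrite (_ : (fun n => _) = (fun n : nat => exponent (1 * n.+1%:R^-1) - A +
     kappa0 * ln (n.+1%:R^-1 + r))); last first.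
    by apply/funext => n; rewrite /exponent mul1r; ring.
  rewrite [X in _ --> X](_ : _ = (0 - A) + kappa0 * ln r); last by ring.
  apply: cvgD.
    by apply: cvgB; [apply: exponent_cvg0; rewrite ltr01 lexx|exact: cvg_cst].
  apply: cvgM; first exact: cvg_cst.
  rewrite -[in X in _ --> X](add0r r).
  apply: (@continuous_cvg _ _ _ _ _ _ (@ln R)); first by apply: continuous_ln; rewrite add0r.
  by apply: cvgD; [exact: cvg_harmonic|exact: cvg_cst].
have [g g0 gE] := gamma_law k0 r0.
exists (affine_law 1 nu g); first exact: affine_law_nonneg.
move=> l; rewrite le_eqVlt => /predU1P[<-|l0].
  by rewrite laplace0 L_at0.
rewrite laplace_affine_law mul1r nuE// gE ?(ltW l0)// -EFinM LE//; congr EFin.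
have rl1 : 0 < r + l by apply: addr_gt0.
have rl0 : 0 < r / (r + l) by rewrite divr_gt0.
rewrite /powR gt_eqF// -expRD ln_div ?posrE//; congr expR.
by rewrite /exponent (addrC r l); ring.
Qed.

Lemma criterion_sufficient : t0 R <= t -> is_SD0_laplace L.
Proof.
move=> tt0; have [mu mu0 muL] := law_exists tt0.
exists mu; split => // c c01; have [c0 c1] := andP c01.
have [nu nu0 nuE] := cofactor_law tt0 c01.
exists nu => B mB; change (mu B = affine_law c mu nu B).
apply: laplace_inj => //; first by apply: affine_law_nonneg => //; exact: ltW.
move=> l; rewrite le_eqVlt => /predU1P[<-|l0]; first by rewrite !laplace0.
have cl0 : 0 < c * l by rewrite mulr_gt0.
rewrite laplace_affine_law nuE// !muL ?(ltW l0) ?(ltW cl0)// -EFinM; congr EFin.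
by field; rewrite gt_eqF// L_gt0// ltW.
Qed.

Let rho_int_le l : 1 <= l ->
  `|rho_int l| <= `|levy_int_coef t a b w| + levy_int_bound t a b w.
Proof.
move=> l1; have l0 : 0 < l by exact: lt_le_trans l1.
have := levy_int_asymp t_gt0 a_gt0 ab w_gt0 l0.
set p := levy_int_coef t a b w; set q := levy_int_bound t a b w => H.
have q0 : 0 <= q.
  have := le_trans (normr_ge0 _) H; rewrite pmulr_lge0// invr_gt0 exprn_gt0//.
rewrite -(subrK (p / l) (rho_int l)) addrC (le_trans (ler_normD _ _))// lerD//.
  rewrite normrM normfV (gtr0_norm l0) ler_piMr// invf_le1//.
apply: (le_trans H); rewrite ler_piMr// invf_le1 ?exprn_gt0//.
by rewrite exprn_ege1.
Qed.

(* [L <= 1] forces [L] to decay, not grow, like a power of [l]. *)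
Lemma criterion_ge_half : (forall l, 0 <= l -> L l <= 1) -> 2^-1 <= t.
Proof.
move=> L1; rewrite leNgt; apply/negP => th.
have k0 : kappa0 < 0.
  rewrite /canonical_fun0 pmulr_rlt0 ?subr_lt0// mulr_gt0// subr_gt0//.
pose M := `|levy_int_coef t a b w| + levy_int_bound t a b w.
(* At this point -k0 ln l >= M + 1 - A, and |rho_int| <= M, so the exponent is at least 1. *)
pose l := expR (`|(M + 1 - A) / - kappa0| ).
have l1 : 1 <= l by rewrite -expR0 ler_expR.
have l0 : 0 < l by exact: expR_gt0.
have := L1 l (ltW l0); rewrite LE// expR_le1 /exponent /l expRK -/l.
have := rho_int_le l1; rewrite -/M ler_norml => /andP[rl _].
have := ler_norm ((M + 1 - A) / - kappa0).
rewrite ler_pdivrMr ?oppr_gt0//; lra.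
Qed.

(** For c = 1/2 the logarithm of the ratio is D(l) plus a constant, where D(l) = -p/l + O(1/l^2)
    because p/l - p/(l/2) = -p/l. Being nonincreasing with limit 0, D is nonnegative; this forces p
    <= 0, that is B_2(t) >= 0. *)
Lemma criterion_necessary : is_SD0_laplace L -> t0 R <= t.
Proof.
move=> [mu [mu0 sd muL]].
have th : 2^-1 <= t.
  apply: criterion_ge_half => l l0; rewrite -lee_fin -muL// -(laplace0 mu).
  exact: laplace_nincr.
have half01 : 0 < (2^-1 : R) < 1 by rewrite invr_gt0 ltr0n/= invf_lt1// ltr1n.
have dec := selfdecomposable_ratio mu0 sd muL L_gt0 half01.
set p := levy_int_coef t a b w; set q := levy_int_bound t a b w.
pose D l := rho_int l - rho_int (2^-1 * l).
have LD l : 0 < l -> L l / L (2^-1 * l) = expR (D l + kappa0 * ln 2^-1).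
  move=> l0; have hl0 : 0 < 2^-1 * l by rewrite mulr_gt0.
  by rewrite !LE// -expRB; congr expR; rewrite /exponent /D lnM ?posrE//; ring.
have Dnincr l m : 0 < l -> l < m -> D m <= D l.
  move=> l0 lm; have := dec l m (ltW l0) lm.
  by rewrite !LD ?(lt_trans l0 lm)// ler_expR lerD2r.
have Dasymp l : 0 < l -> `|D l + p / l| <= 5 * q / l ^+ 2.
  move=> l0; have hl0 : 0 < 2^-1 * l by rewrite mulr_gt0.
  have h1 := levy_int_asymp t_gt0 a_gt0 ab w_gt0 l0.
  have h2 := levy_int_asymp t_gt0 a_gt0 ab w_gt0 hl0.
  rewrite -/p -/q in h1 h2.
  have -> : D l + p / l = (rho_int l - p / l) - (rho_int (2^-1 * l) - p / (2^-1 * l)).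
    by rewrite /D; field; rewrite gt_eqF.
  rewrite (_ : 5 * q / l ^+ 2 = q / l ^+ 2 + q / (2^-1 * l) ^+ 2); last by field; rewrite gt_eqF.
  by rewrite (le_trans (ler_normB _ _))// lerD.
have D0 l : 0 < l -> 0 <= D l.
  move=> l0; apply/ler_addgt0Pr => e e0.
  (* So far out, [Dasymp] gives D(m) >= -e, and D(l) >= D(m). *)
  pose m := Num.max (l + 1) (Num.max 1 ((`|p| + 5 * `|q|) / e)).
  have lm : l < m by rewrite lt_max ltrDl ltr01.
  have m1 : 1 <= m by rewrite !le_max lexx orbT.
  have me : (`|p| + 5 * `|q|) / e <= m by rewrite !le_max lexx !orbT.
  have m0 : 0 < m by exact: lt_trans lm.
  have := Dnincr l m l0 lm; have := Dasymp m m0; rewrite ler_norml => /andP[h _].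
  have h1 : p / m <= `|p| / m by rewrite ler_pM2r ?invr_gt0// ler_norm.
  have h2 : 5 * q / m ^+ 2 <= 5 * `|q| / m.
    apply: (@le_trans _ _ (5 * `|q| / m ^+ 2)).
      by rewrite ler_pM2r ?invr_gt0 ?exprn_gt0// ler_pM2l// ler_norm.
    rewrite ler_wpM2l ?mulr_ge0// lef_pV2 ?posrE ?exprn_gt0// expr2 ler_peMl//.
    exact: ltW.
  have h3 : (`|p| + 5 * `|q|) / m <= e by rewrite ler_pdivrMr// [leRHS]mulrC -ler_pdivrMr.
  rewrite mulrDl in h3; lra.
have p0 : p <= 0.
  rewrite leNgt; apply/negP => p0.
  (* This choice makes p l = 5 |q| + 1, so that p/l exceeds the error term 5q/l^2 and D(l) would be
     negative. *)
  pose l := (5 * `|q| + 1) / p.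
  have l0 : 0 < l by rewrite divr_gt0// ltr_wpDl// mulr_ge0.
  have := Dasymp l l0; rewrite ler_norml => /andP[_ h].
  have := D0 l l0 => h0.
  have : p / l <= 5 * q / l ^+ 2 by lra.
  rewrite ler_pdivrMr// (_ : _ * l = 5 * q / l); last by field; rewrite gt_eqF.
  rewrite ler_pdivlMr// /l mulrCA divff ?gt_eqF// mulr1.
  have := ler_norm q; lra.
have B0 : 0 <= bernoulli2 t.
  move: p0; rewrite /p /levy_int_coef => p0.
  have ab2 : 0 < b ^+ 2 - a ^+ 2 by rewrite subr_gt0 ltrXn2r// ?nnegrE ltW.
  rewrite leNgt; apply/negP => B0.
  have : 0 < w * (b ^+ 2 - a ^+ 2) * (- bernoulli2 t / 2).
    by apply: mulr_gt0; [exact: mulr_gt0|rewrite divr_gt0// oppr_gt0].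
  lra.
have s3 : 0 < Num.sqrt 3 :> R by rewrite sqrtr_gt0.
have s32 : Num.sqrt 3 ^+ 2 = 3 :> R by rewrite sqr_sqrtr.
have u0 : 0 <= (2 * Num.sqrt 3)^-1 :> R by rewrite invr_ge0 mulr_ge0// ltW.
have s0 : 0 <= t - 2^-1 by rewrite subr_ge0.
(* B_2(t) >= 0 reads (t - 1/2)^2 >= 1/12; t >= 1/2 allows the square root and excludes values below
   the smaller root of B_2. *)
rewrite /t0 -lerBrDl -(@ler_pXn2r _ 2)//.
rewrite exprVn exprMn s32; move: B0; rewrite /bernoulli2.
have : (2 ^+ 2 * 3)^-1 = 12^-1 :> R by congr _^-1; ring.
lra.
Qed.

End selfdecomposability_criterion.

(** * Application to [G] and its inverse *)

Section gamma_ratios.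
Variable R : realType.
Implicit Types (alpha t l h M K a b w : R) (L : R -> R).

(** By convexity the chord over [t, t + M] bounds the increments from above, and the slope of a
    chord ending at t bounds them from below. *)
Lemma lngamma_lipschitz_right t M : 0 < t -> 0 < M -> exists2 K, 0 <= K &
  forall h, 0 <= h <= M -> `|lngamma (h + t) - lngamma t| <= K * h.
Proof.
move=> t0 M0; pose d := t / 2; have d0 : 0 < d by rewrite divr_gt0.
have dt : 0 < d < t by rewrite d0 /d ltr_pdivrMr// ltr_pMr// ltr1n.
pose K1 := (lngamma (t + M) - lngamma t) / M.
pose K2 := (lngamma t - lngamma (t - d)) / d.
exists (`|K1| + `|K2|) => [|h /andP[h0 hM]]; first by rewrite addr_ge0.
have w01 : 0 <= h / M <= 1 by rewrite divr_ge0 ?(ltW M0)//= ler_pdivrMr// mul1r.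
have up : lngamma (h + t) - lngamma t <= K1 * h.
  have := lngamma_convex w01 t0 (addr_gt0 t0 M0).
  have -> : (1 - h / M) * t + h / M * (t + M) = h + t by field; rewrite gt_eqF.
  rewrite (_ : K1 * h = h / M * (lngamma (t + M) - lngamma t)); last by rewrite /K1; ring.
  lra.
have lo : K2 * h <= lngamma (h + t) - lngamma t.
  have := lngamma_slope_ge dt h0; rewrite (addrC t h) mulrC -ler_pdivrMl//.
  by rewrite (_ : d^-1 * _ = K2 * h)//; rewrite /K2; ring.
have := ler_norm K1; have := ler_norm (- K2); rewrite normrN => k2 k1.
have n1 := normr_ge0 K1; have n2 := normr_ge0 K2.
rewrite ler_norml; apply/andP; split; nra.
Qed.

(** The O(l) bound at 0 is read off the Gamma side: a times the increment of ln Gamma over a step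
    l/a is at most a constant times l, and likewise for b. *)
Lemma gamma_ratio_criterion t a b w L : 0 < t -> 0 < a -> a < b -> 0 < w ->
  (forall l, 0 <= l -> L l = expR (w * (b - a) * lngamma t - w * (ln b - ln a) * l +
     w * (a * lngamma (l / a + t) - b * lngamma (l / b + t)))) ->
  is_SD0_laplace L <-> t0 R <= t.
Proof.
move=> tgt0 agt0 ab wgt0 LE; have bgt0 := lt_trans agt0 ab.
have [A AE] := lngamma_ratio_formula w tgt0 agt0 ab.
have L1 : L 0 = 1.
  by rewrite LE// !mul0r add0r mulr0 subr0 -[RHS]expR0; congr expR; ring.
pose A' := A + w * (b - a) * lngamma t.
have expE l : 0 < l -> w * (b - a) * lngamma t - w * (ln b - ln a) * l +
     w * (a * lngamma (l / a + t) - b * lngamma (l / b + t)) =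
     A' - canonical_fun0 t a b w * ln l + levy_int t a b w l.
  by move=> l0; rewrite AE// /A'; ring.
have LE' l : 0 < l -> L l = expR (A' - canonical_fun0 t a b w * ln l + levy_int t a b w l).
  by move=> l0; rewrite LE ?ltW// expE.
have ai0 : 0 < a^-1 by rewrite invr_gt0.
have bi0 : 0 < b^-1 by rewrite invr_gt0.
have [Ka Ka0 lipa] := lngamma_lipschitz_right tgt0 ai0.
have [Kb Kb0 lipb] := lngamma_lipschitz_right tgt0 bi0.
pose K := w * (Ka + Kb + `|ln b - ln a|).
have lip l : 0 < l <= 1 ->
    `|A' - canonical_fun0 t a b w * ln l + levy_int t a b w l| <= K * l.
  move=> /andP[l0 l1]; rewrite -expE//.
  have la : 0 <= l / a <= a^-1.
    by rewrite divr_ge0 ?(ltW l0) ?(ltW agt0)//= ler_piMl// invr_ge0 (ltW agt0).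
  have lb : 0 <= l / b <= b^-1.
    by rewrite divr_ge0 ?(ltW l0) ?(ltW bgt0)//= ler_piMl// invr_ge0 (ltW bgt0).
  have := lipa _ la; have := lipb _ lb; set x := lngamma (l / a + t); set y := lngamma (l / b + t).
  move=> hy hx.
  rewrite [X in `|X|](_ : _ = w * (a * (x - lngamma t) - b * (y - lngamma t) -
    (ln b - ln a) * l)); last by ring.
  rewrite normrM (gtr0_norm wgt0) /K -mulrA ler_pM2l//.
  have xl : `|a * (x - lngamma t)| <= Ka * l.
    by rewrite normrM (gtr0_norm agt0) -ler_pdivlMl// mulrCA [a^-1 * l]mulrC.
  have yl : `|b * (y - lngamma t)| <= Kb * l.
    by rewrite normrM (gtr0_norm bgt0) -ler_pdivlMl// mulrCA [b^-1 * l]mulrC.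
  apply: (le_trans (ler_normB _ _)).
  rewrite [X in _ <= X]mulrDl lerD//; last by rewrite normrM (gtr0_norm l0).
  by rewrite (le_trans (ler_normB _ _))// mulrDl lerD.
split; first exact: (criterion_necessary tgt0 agt0 ab wgt0 L1 LE').
exact: (criterion_sufficient tgt0 agt0 ab wgt0 L1 LE' lip).
Qed.

Definition ln_G alpha t l : R := (1 - alpha) * lngamma t + alpha * l * ln alpha +
  alpha * lngamma (l + t) - lngamma (alpha * l + t).

Lemma G_expR alpha t l : 0 < alpha -> 0 < t -> 0 <= l -> G alpha t l = expR (ln_G alpha t l).
Proof.
move=> al0 tgt0 l0; have lt0 : 0 < l + t by rewrite ltr_wpDl.
have alt0 : 0 < alpha * l + t by rewrite ltr_wpDl// mulr_ge0// ltW.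
rewrite /G !GammaE_expR//; set x := lngamma t; set y := lngamma (l + t).
set z := lngamma (alpha * l + t).
by rewrite /powR !gt_eqF ?expR_gt0// !expRK -!expRD -expRB.
Qed.

(* For [c = alpha < 1] (for 1/G) or [c = alpha^-1 < 1] (for G), a law with this
   Laplace transform would have the negative mean [- `|alpha * ln alpha|]; iterating
   the inequality avoids differentiating [lngamma]. *)
Lemma contraction_of_Gamma_ratio_false t (c : R) : 0 < t -> 0 < c < 1 ->
  (forall l, 0 < l <= 1 -> (lngamma (c * l + t) - lngamma t) / (c * l) <=
     (lngamma (l + t) - lngamma t) / l + ln c) -> False.
Proof.
move=> tgt0 c01 H; have [K K0 lip] := lngamma_lipschitz_right tgt0 ltr01.
apply: (@unbounded_below_contraction R (fun l => (lngamma (l + t) - lngamma t) / l) c (- K)) => //.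
move=> l /andP[l0 l1]; rewrite ler_pdivlMr// mulNr.
by have := lip l; rewrite (ltW l0) l1 => /(_ isT); rewrite ler_norml => /andP[].
Qed.

Lemma is_SD0_laplace_le1 L : is_SD0_laplace L -> forall l, 0 <= l -> L l <= 1.
Proof.
move=> [mu [mu0 _ muL]] l l0; rewrite -lee_fin -muL// -(laplace0 mu).
exact: laplace_nincr.
Qed.

(** At l / alpha the denominator of [G] becomes Gamma(l + t), so the bound compares the slopes of ln
    Gamma at steps l / alpha and l: a contraction with ratio 1 / alpha. *)
Lemma G_le1_false alpha t : 1 < alpha -> 0 < t ->
  (forall l, 0 <= l -> G alpha t l <= 1) -> False.
Proof.
move=> al1 tgt0 G1; have al0 : 0 < alpha by exact: lt_trans al1.
have c01 : 0 < alpha^-1 < 1 by rewrite invr_gt0 al0 invf_lt1.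
apply: (contraction_of_Gamma_ratio_false tgt0 c01) => l /andP[l0 _].
have cl0 : 0 < alpha^-1 * l by rewrite mulr_gt0 ?invr_gt0.
have := G1 _ (ltW cl0); rewrite G_expR ?(ltW cl0)// expR_le1 /ln_G mulVKf ?gt_eqF//.
set x := lngamma t; set y := lngamma (l + t); set z := lngamma (_ * l + t) => H.
rewrite lnV ?posrE// -subr_ge0.
have -> : (y - x) / l - ln alpha - (z - x) / (alpha^-1 * l) =
  - ((1 - alpha) * x + l * ln alpha + alpha * z - y) / l by field; rewrite !gt_eqF.
by rewrite divr_ge0 ?(ltW l0)// oppr_ge0.
Qed.

Lemma G_inv_le1_false alpha t : 0 < alpha < 1 -> 0 < t ->
  (forall l, 0 <= l -> (G alpha t l)^-1 <= 1) -> False.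
Proof.
move=> al01 tgt0 G1; have [al0 al1] := andP al01.
apply: (contraction_of_Gamma_ratio_false tgt0 al01) => l /andP[l0 _].
have := G1 _ (ltW l0); rewrite G_expR ?(ltW l0)// -expRN expR_le1 /ln_G.
set x := lngamma t; set y := lngamma (l + t); set z := lngamma (_ * l + t) => H.
rewrite -subr_ge0.
have -> : (y - x) / l + ln alpha - (z - x) / (alpha * l) =
  ((1 - alpha) * x + alpha * l * ln alpha + alpha * y - z) / (alpha * l).
  by field; rewrite !gt_eqF.
by rewrite divr_ge0 ?mulr_ge0 ?(ltW l0) ?(ltW al0)//; lra.
Qed.

End gamma_ratios.

Theorem theorem2 (R : realType) (alpha t : R) :
  0 < alpha -> alpha != 1 -> 0 < t ->
  (is_SD0_laplace (fun lam => G alpha t lam) <-> (alpha < 1 /\ t0 R <= t)) /\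
  (is_SD0_laplace (fun lam => (G alpha t lam)^-1) <-> (1 < alpha /\ t0 R <= t)).
Proof.
move=> al0 al1 tgt0; have ali0 : 0 < alpha^-1 by rewrite invr_gt0.
have case1 : alpha < 1 -> is_SD0_laplace (fun lam => G alpha t lam) <-> t0 R <= t.
  move=> al_lt1; apply: (@gamma_ratio_criterion R t 1 alpha^-1 alpha) => //.
    by rewrite invf_gt1.
  move=> l l0; rewrite G_expR// /ln_G ln1 lnV ?posrE// divr1 invrK (mulrC l).
  by congr expR; field; rewrite gt_eqF.
have case2 : 1 < alpha -> is_SD0_laplace (fun lam => (G alpha t lam)^-1) <-> t0 R <= t.
  move=> al_gt1; apply: (@gamma_ratio_criterion R t alpha^-1 1 alpha) => //.
    by rewrite invf_lt1.
  move=> l l0; rewrite G_expR// -expRN /ln_G ln1 lnV ?posrE// divr1 invrK (mulrC l).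
  by congr expR; field; rewrite gt_eqF.
split; split.
- move=> sd; have [al_lt1|al_gt1|al_eq1] := ltgtP alpha 1.
  + by split => //; exact/case1.
  + by have := G_le1_false al_gt1 tgt0 (is_SD0_laplace_le1 sd).
  + by rewrite al_eq1 eqxx in al1.
- by move=> [/case1 H /H].
- move=> sd; have [al_lt1|al_gt1|al_eq1] := ltgtP alpha 1.
  + by have := @G_inv_le1_false R alpha t; rewrite al0 => /(_ al_lt1 tgt0 (is_SD0_laplace_le1 sd)).
  + by split => //; exact/case2.
  + by rewrite al_eq1 eqxx in al1.
- by move=> [/case2 H /H].
Qed.
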